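(* Let $R$ be a right hereditary and right Noetherian ring. Then the following are equivalent. (1) $R$ is right almost-$QF$. (2) $R$ is right max-$QF$. (3) Every injective right $R$-module $E$ has a decomposition $E=A\oplus B$ where $\operatorname{Rad}(A)=A$ and $B$ is projective and semisimple. (4) $R=S\times T$ (as rings), where $S$ is a semisimple Artinian ring and $T$ is a right small ring.
   Context: Rings are associative with identity; modules are unital right modules. A right $R$-module $M$ is $R$-projective if for every right ideal $I$ of $R$, every homomorphism $M\to R/I$ factors through the canonical projection $R\to R/I$. $M$ is max-projective if for every maximal right ideal $I$ of $R$, every homomorphism $M\to R/I$ factors through the canonical projection $R\to R/I$. A ring $R$ is right almost-$QF$ (resp. right max-$QF$) if every injective right $R$-module is $R$-projective (resp. max-projective). A submodule $K$ of $M$ is superfluous, written $K\ll M$, if $K+L\neq M$ for every proper submodule $L$ of $M$. $R$ is a right small ring if $R_R\ll E(R_R)$, where $E(R_R)$ is the injective hull of $R_R$. $\operatorname{Rad}(M)$ is the Jacobson radical of $M$ (the intersection of all maximal submodules, equal to $M$ if there are none). In the product decomposition a factor is allowed to be the zero ring. *)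

(* Defs.v *)
From HB Require Import structures.
From mathcomp Require Import all_boot all_order all_algebra.
From mathcomp Require Import boolp classical_sets.

Set Implicit Arguments.
Unset Strict Implicit.
Unset Printing Implicit Defensive.

Import GRing.Theory.
Local Open Scope classical_set_scope.
Local Open Scope ring_scope.
Local Open Scope quotient_scope.

(* Rings are [pzRingType]s, so that the zero ring is allowed.  MathComp has   *)
(* left modules only: a right R-module is an [lmodType R^c], where R^c is the *)
(* converse ring of R.  In particular R_R is [R^c^o], whose scaling is        *)
(* a *: x = x * a computed in R, and a right ideal of R is a submodule of     *)
(* [R^c^o].  Submodules are [submodClosed M]; these are boolean predicates,   *)
(* which classically (asbool of boolp) means arbitrary submodules.            *)

Section SubQuotient.
Variables (K : pzRingType) (M : lmodType K) (N : submodClosed M).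

(* [submodClosed] is defined over semirings, so it does not provide closure   *)
(* under opposite, which the quotient construction requires.                  *)
Definition zmod_of_submod : {pred M} := fun x => x \in N.

Fact zmod_of_submod_closed : zmod_closed zmod_of_submod.
Proof.
split=> [|x y xN yN]; rewrite /zmod_of_submod unfold_in ?rpred0 //.
by apply: rpredD => //; rewrite -scaleN1r; apply: rpredZ.
Qed.

HB.instance Definition _ :=
  GRing.isZmodClosed.Build M zmod_of_submod zmod_of_submod_closed.

Definition quotmod : Type := Quotient.quot zmod_of_submod.

HB.instance Definition _ := GRing.Zmodule.on quotmod.
HB.instance Definition _ := Quotient.on quotmod.

Definition quotmod_scale (a : K) (x : quotmod) : quotmod :=
  \pi_quotmod (a *: repr x).

Lemma pi_quotmod_scale a x :
  \pi_quotmod (a *: x) = quotmod_scale a (\pi_quotmod x).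
Proof.
apply/eqP; rewrite -[_ == _]Quotient.idealrBE -scalerBr.
apply: (rpredZ (s := N)); change (x - repr (\pi_quotmod x) \in zmod_of_submod).
by rewrite Quotient.idealrBE reprK.
Qed.

Fact quotmod_scaleA a b x :
  quotmod_scale a (quotmod_scale b x) = quotmod_scale (a * b) x.
Proof.
elim/quotW: x => x; rewrite -(pi_quotmod_scale b x) -(pi_quotmod_scale a).
by rewrite -(pi_quotmod_scale (a * b)) scalerA.
Qed.

Fact quotmod_scale1 : left_id 1 quotmod_scale.
Proof. by elim/quotW=> x; rewrite -pi_quotmod_scale scale1r. Qed.

Fact quotmod_scaleDr : right_distributive quotmod_scale +%R.
Proof.
move=> a; elim/quotW=> x; elim/quotW=> y.
rewrite -(pi_quotmod_scale a x) -(pi_quotmod_scale a y).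
have pD := @Quotient.pi_add M zmod_of_submod.
by rewrite -[LHS]/(quotmod_scale a (Quotient.add _ _)) -pD -pi_quotmod_scale
  scalerDr pD.
Qed.

Fact quotmod_scaleDl x : {morph quotmod_scale^~ x : a b / a + b}.
Proof.
elim/quotW: x => x a b /=.
rewrite -(pi_quotmod_scale a x) -(pi_quotmod_scale b x).
rewrite -(pi_quotmod_scale (a + b) x) scalerDl.
exact: (@Quotient.pi_add M zmod_of_submod).
Qed.

HB.instance Definition _ := GRing.Zmodule_isLmodule.Build K quotmod
  quotmod_scaleA quotmod_scale1 quotmod_scaleDr quotmod_scaleDl.

Definition quot_proj : M -> quotmod := \pi_quotmod.

Fact quot_proj_is_linear : linear quot_proj.
Proof.
move=> a x y; rewrite /quot_proj -[RHS]/(Quotient.add (quotmod_scale _ _) _).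
by rewrite -pi_quotmod_scale -(@Quotient.pi_add M zmod_of_submod).
Qed.

HB.instance Definition _ :=
  GRing.isLinear.Build K M quotmod *:%R quot_proj quot_proj_is_linear.

Definition submod : Type := {x : M | x \in N}.

HB.instance Definition _ := SubChoice.on submod.
HB.instance Definition _ := [SubChoice_isSubLmodule of submod by <:].

End SubQuotient.

Section ModuleNotions.
Variable K : pzRingType.
Implicit Types M E : lmodType K.

Definition injective_module E : Prop :=
  forall (M N : lmodType K) (f : {linear M -> N}) (g : {linear M -> E}),
    injective f -> exists h : {linear N -> E}, g =1 h \o f.

Definition projective_module (P : lmodType K) : Prop :=
  forall (M N : lmodType K) (f : {linear M -> N}) (g : {linear P -> N}),
    range f = setT -> exists h : {linear P -> M}, g =1 f \o h.

Definition submodule_sum M (A B : set M) : set M :=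
  [set a + b | a in A & b in B].

Definition proper_submodule M (N : submodClosed M) : Prop :=
  [set` N] <> setT.

Definition maximal_submodule M (N : submodClosed M) : Prop :=
  proper_submodule N /\
  forall L : submodClosed M, [set` N] `<=` [set` L] -> proper_submodule L ->
    [set` L] = [set` N].

Definition Rad M : set M :=
  [set x | forall N : submodClosed M, maximal_submodule N -> x \in N].

Definition internal_direct_sum M (A B : submodClosed M) : Prop :=
  submodule_sum [set` A] [set` B] = setT /\ [set` A] `&` [set` B] = [set 0].

Definition semisimple_module M : Prop :=
  forall A : submodClosed M, exists B : submodClosed M, internal_direct_sum A B.

(* The superfluous and essential subsets used below are submodules given as   *)
(* ranges of linear maps.                                                     *)
Definition superfluous M (A : set M) : Prop :=
  forall L : submodClosed M, proper_submodule L ->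
    submodule_sum A [set` L] <> setT.

Definition essential M (A : set M) : Prop :=
  forall L : submodClosed M, [set` L] <> [set 0] -> A `&` [set` L] <> [set 0].

Definition injective_hull M E (i : {linear M -> E}) : Prop :=
  [/\ injective_module E, injective i & essential (range i)].

End ModuleNotions.

Arguments Rad {K} M.

Section RightNotions.
Variable R : pzRingType.

Definition R_projective (M : lmodType R^c) : Prop :=
  forall (I : submodClosed R^c^o) (f : {linear M -> quotmod I}),
    exists g : {linear M -> R^c^o}, f =1 quot_proj I \o g.

Definition max_projective (M : lmodType R^c) : Prop :=
  forall I : submodClosed R^c^o, maximal_submodule I ->
  forall f : {linear M -> quotmod I},
    exists g : {linear M -> R^c^o}, f =1 quot_proj I \o g.

Definition right_almost_QF : Prop :=
  forall E : lmodType R^c, injective_module E -> R_projective E.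

Definition right_max_QF : Prop :=
  forall E : lmodType R^c, injective_module E -> max_projective E.

Definition right_hereditary : Prop :=
  forall I : submodClosed R^c^o, projective_module (submod I).

Definition right_noetherian : Prop :=
  forall I : nat -> submodClosed R^c^o,
    (forall n, [set` I n] `<=` [set` I n.+1]) ->
    exists n, forall m, (n <= m)%N -> [set` I m] = [set` I n].

Definition right_artinian : Prop :=
  forall I : nat -> submodClosed R^c^o,
    (forall n, [set` I n.+1] `<=` [set` I n]) ->
    exists n, forall m, (n <= m)%N -> [set` I m] = [set` I n].

(* For a semisimple ring the left and right conditions are equivalent, so it  *)
(* is enough to record the right ones.                                        *)
Definition semisimple_artinian : Prop :=
  semisimple_module R^c^o /\ right_artinian.

Definition right_small : Prop :=
  exists (E : lmodType R^c) (i : {linear R^c^o -> E}),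
    injective_hull i /\ superfluous (range i).

End RightNotions.

(* Main.v *)
Require Import Defs.
From HB Require Import structures.
From mathcomp Require Import all_boot all_order all_algebra.
From mathcomp Require Import boolp classical_sets functions.

Set Implicit Arguments.
Unset Strict Implicit.
Unset Printing Implicit Defensive.

Import GRing.Theory.
Local Open Scope classical_set_scope.
Local Open Scope ring_scope.

(** Write K for the converse ring of R, so that right R-modules are left
    K-modules.  The proof is organised around the modules that are at once
    injective, projective and semisimple ([ips_module]) and around their trace
    in a module M, the set [ips_trace M] of all values of linear maps from such
    modules to M.  This class is closed under quotients, submodules and finite
    products, so the trace is a submodule, and it plays the part of the sum of
    all simple injective projective submodules without any choice of simple
    summands.

    Two closure properties carry everything.  Over a hereditary ring a quotient
    of an injective module is injective ([hereditary_quotient]): by Baer's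
    criterion it is enough to extend maps from ideals, which are projective, so
    such maps lift to the injective module.  Over a Noetherian ring the trace
    of any module is itself injective, projective and semisimple
    ([ips_trace_ips]): a map from an ideal to the trace already lands in the
    image of a single member of the class, and projectivity and semisimplicity
    pass to directed unions by Zorn's lemma.

    (1) to (2) is a special case.

    (2) to (3): the trace B of an injective module E is injective, so E is the
    direct sum of B and some A.  If A had a maximal submodule N, then A/N would
    be a simple injective module isomorphic to some R/I with I maximal, and the
    max-projectivity of A/N itself would lift this isomorphism to R and make
    A/N projective.  So A would contain a copy of A/N, which lies in the trace
    B and outside N ([max_QF_trace_maximal]); as A meets B in 0, this is absurd.

    (3) to (4): the trace of R is an injective right ideal, hence eR for some
    idempotent e.  It is fully invariant, and eR(1-e) = 0 because elements of a
    trace can be lifted along any linear map ([ips_trace_reflect]); so e is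
    central.  The corner at e is semisimple.  The corner T at 1-e has an
    injective hull Q over R ([corner_hull]), which by (3) is A + B with
    Rad A = A and B in the class; B meets T in the trace of R, hence in 0, so
    B = 0 and Q has no maximal submodule.  If T + L = Q for some proper L, then
    Q/L would be cyclic and nonzero and would provide one.

    (4) to (1): the image of a map from an injective module to R/I is a cyclic
    injective module xR.  Its T-part is 0, because the map from T to it extends
    to the hull of T and the kernel of the extension is a supplement of T
    ([right_small_kills_cyclic]).  So it is a quotient of the semisimple module
    S, hence projective, and its inclusion in R/I lifts to R. *)

(** * Submodules and linear maps given by propositions *)

Section Submodules.
Variable K : pzRingType.
Implicit Types M N : lmodType K.

(** Bundled submodules are boolean predicates; this unbundled form lets a
    submodule be described by an arbitrary property. *)
Definition is_submod M (P : set M) : Prop :=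
  [/\ P 0, forall x y, P x -> P y -> P (x + y) & forall a x, P x -> P (a *: x)].

Definition submod_pred M (P : set M) of is_submod P : {pred M} :=
  fun x => `[< P x >].

Fact submod_pred_closed M (P : set M) (hP : is_submod P) :
  subsemimod_closed (submod_pred hP).
Proof.
case: (hP) => P0 PD PZ; split; first split.
- exact/asboolP.
- by move=> x y /asboolP Px /asboolP Py; apply/asboolP/PD.
- by move=> a x /asboolP Px; apply/asboolP/PZ.
Qed.

HB.instance Definition _ M (P : set M) (hP : is_submod P) :=
  GRing.isSubmodClosed.Build K M (submod_pred hP) (submod_pred_closed hP).

Definition submod_of M (P : set M) (hP : is_submod P) : submodClosed M :=
  submod_pred hP.

Lemma submod_ofP M (P : set M) (hP : is_submod P) x :
  reflect (P x) (x \in submod_of hP).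
Proof. exact: asboolP. Qed.

Fact submodZ M (N : submodClosed M) a x : x \in N -> a *: x \in N.
Proof. exact: rpredZ. Qed.

Fact submodN M (N : submodClosed M) x : x \in N -> - x \in N.
Proof. by move=> xN; rewrite -scaleN1r; apply: rpredZ. Qed.

Fact submodB M (N : submodClosed M) x y : x \in N -> y \in N -> x - y \in N.
Proof. by move=> xN yN; apply: rpredD => //; apply: submodN. Qed.

Fact mem_is_submod M (N : submodClosed M) : is_submod [set` N].
Proof.
by split=> /= [|x y xN yN|a x xN]; [apply: rpred0|apply: rpredD|apply: rpredZ].
Qed.

Fact ker_is_submod M N (u : {linear M -> N}) : is_submod [set x | u x = 0].
Proof.
by split=> /= [|x y ux uy|a x ux]; rewrite ?raddf0 // ?linearD ?linearZ /=
  ?ux ?uy ?addr0 ?scaler0.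
Qed.

Fact range_is_submod M N (u : {linear M -> N}) : is_submod (range u).
Proof.
split=> [|_ _ [x _ <-] [y _ <-]|a _ [x _ <-]].
- by exists 0; rewrite ?raddf0.
- by exists (x + y); rewrite ?raddfD.
- by exists (a *: x); rewrite ?linearZ.
Qed.

Fact preim_is_submod M N (u : {linear M -> N}) (A : submodClosed N) :
  is_submod [set x | u x \in A].
Proof.
by split=> /= [|x y xA yA|a x xA]; rewrite ?raddf0 ?linearD ?linearZ /=
  ?rpred0 ?rpredD ?rpredZ.
Qed.

Fact sum_is_submod M (A B : submodClosed M) :
  is_submod (submodule_sum [set` A] [set` B]).
Proof.
split=> [|_ _ [a aA [b bB <-]] [c cA [d dB <-]]|k _ [a aA [b bB <-]]].
- by exists 0; rewrite /= ?rpred0 //; exists 0; rewrite /= ?rpred0 ?addr0.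
- exists (a + c); first exact: rpredD.
  by exists (b + d); [exact: rpredD|rewrite addrACA].
- exists (k *: a); first exact: rpredZ.
  by exists (k *: b); [exact: rpredZ|rewrite scalerDr].
Qed.

Fact cap_is_submod M (A B : submodClosed M) :
  is_submod [set x | x \in A /\ x \in B].
Proof.
by split=> /= [|x y [xA xB] [yA yB]|k x [xA xB]]; split;
  rewrite ?rpred0 ?rpredD ?rpredZ.
Qed.

Fact cyclic_is_submod M (x : M) : is_submod [set a *: x | a in [set: K]].
Proof.
split=> [|_ _ [a _ <-] [b _ <-]|k _ [a _ <-]].
- by exists 0; rewrite ?scale0r.
- by exists (a + b); rewrite ?scalerDl.
- by exists (k * a); rewrite ?scalerA.
Qed.

Fact zero_is_submod M : is_submod [set (0 : M)].
Proof. by split=> [//|_ _ -> ->|k _ ->] /=; rewrite ?addr0 ?scaler0. Qed.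

Fact full_is_submod M : is_submod [set: M].
Proof. by []. Qed.

Definition sub_ker M N (u : {linear M -> N}) := submod_of (ker_is_submod u).
Definition sub_range M N (u : {linear M -> N}) := submod_of (range_is_submod u).
Definition sub_preim M N (u : {linear M -> N}) A :=
  submod_of (preim_is_submod u A).
Definition sub_sum M (A B : submodClosed M) := submod_of (sum_is_submod A B).
Definition sub_cap M (A B : submodClosed M) := submod_of (cap_is_submod A B).
Definition sub_cyclic M (x : M) := submod_of (cyclic_is_submod x).
Definition sub_zero M := submod_of (zero_is_submod M).
Definition sub_full M := submod_of (full_is_submod M).

Lemma sub_sumP M (A B : submodClosed M) x :
  reflect (exists a b, [/\ a \in A, b \in B & x = a + b]) (x \in sub_sum A B).
Proof.
apply: (iffP (submod_ofP _ _)) => [[a aA [b bB <-]]|[a [b [aA bB ->]]]].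
  by exists a, b.
by exists a => //; exists b.
Qed.

Lemma sub_suml M (A B : submodClosed M) x : x \in A -> x \in sub_sum A B.
Proof. by move=> xA; apply/sub_sumP; exists x, 0; rewrite rpred0 addr0. Qed.

Lemma sub_sumr M (A B : submodClosed M) x : x \in B -> x \in sub_sum A B.
Proof. by move=> xB; apply/sub_sumP; exists 0, x; rewrite rpred0 add0r. Qed.

Lemma sub_cyclicP M (x y : M) :
  reflect (exists a, y = a *: x) (y \in sub_cyclic x).
Proof.
apply: (iffP (submod_ofP _ _)) => [[a _ <-]|[a ->]]; first by exists a.
by exists a.
Qed.

Lemma mem_sub_cyclic M (x : M) : x \in sub_cyclic x.
Proof. by apply/sub_cyclicP; exists 1; rewrite scale1r. Qed.

Lemma internal_direct_sumP M (A B : submodClosed M) :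
  internal_direct_sum A B <->
  (forall x, exists a b, [/\ a \in A, b \in B & x = a + b]) /\
  (forall x, x \in A -> x \in B -> x = 0).
Proof.
split=> [[AB cap]|[AB cap]]; split.
- move=> x; apply/sub_sumP/submod_ofP.
  by rewrite AB.
- by move=> x xA xB; have : ([set` A] `&` [set` B]) x by []; rewrite cap.
- apply/seteqP; split=> // x _.
  by have [a [b [aA bB ->]]] := AB x; exists a => //; exists b.
- apply/seteqP; split=> [x [/= xA xB]|_ ->]; first exact: cap.
  by split; apply: rpred0.
Qed.

Lemma proper_submoduleP M (N : submodClosed M) :
  proper_submodule N <-> exists x, x \notin N.
Proof.
split=> [NT|[x xN] NT]; last first.
  by have : [set` N] x; [rewrite NT|rewrite /= (negbTE xN)].
apply: contrapT => nex; apply: NT; apply/seteqP; split=> // x _ /=.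
by apply: contrapT => /negP xN; apply: nex; exists x.
Qed.

Lemma eq_submodP M (A B : submodClosed M) :
  [set` A] = [set` B] <-> (forall x, (x \in A) = (x \in B)).
Proof.
split=> [AB x|AB]; last by apply/seteqP; split=> x /=; rewrite AB.
apply/idP/idP => xA; first by have : [set` A] x by []; rewrite AB.
by have : [set` B] x by []; rewrite -AB.
Qed.

(** ** Linear maps from functions and from functional relations *)

Lemma linear_exists M N (h : M -> N) : linear h ->
  exists h' : {linear M -> N}, h' =1 h.
Proof.
move=> hl; pose m := GRing.isLinear.Build K M N *:%R h hl.
by exists (HB.pack_for {linear M -> N} h m).
Qed.

(** By linearity, being single-valued at 0 is the same as being single-valued
    everywhere.  Graphs of partial linear maps are handled as submodules of a
    product, so that extending a map is enlarging a submodule. *)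
Definition functional_rel M N (G : submodClosed (M * N)%type) : Prop :=
  forall y, (0, y) \in G -> y = 0.

Lemma functional_rel_uniq M N (G : submodClosed (M * N)%type) x y z :
  functional_rel G -> (x, y) \in G -> (x, z) \in G -> y = z.
Proof.
move=> Gf xy xz; apply/eqP; rewrite -subr_eq0; apply/eqP/Gf.
by rewrite -(subrr x); apply: (@submodB (M * N)%type G (x, y) (x, z)).
Qed.

Lemma linear_of_rel M N (G : submodClosed (M * N)%type) :
  functional_rel G -> (forall x, exists y, (x, y) \in G) ->
  exists h : {linear M -> N}, forall x, (x, h x) \in G.
Proof.
move=> Gf /choice[h hG]; have [|h' h'E] := @linear_exists M N h.
  move=> a x y; apply: (functional_rel_uniq Gf (hG _)).
  by rewrite -[(_, _)]/(a *: (x, h x) + (y, h y)) rpredD ?rpredZ.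
by exists h' => x; rewrite h'E.
Qed.

Lemma lift_sub M N (A : submodClosed N) (u : {linear M -> N}) :
  (forall x, u x \in A) -> exists v : {linear M -> submod A},
  forall x, val (v x) = u x.
Proof.
move=> uA; have [|v vE] := @linear_exists M (submod A) (fun x => Sub (u x) (uA x)).
  by move=> a x y; apply: val_inj; rewrite /= linearP.
by exists v => x; rewrite vE.
Qed.

Definition sub_val M (A : submodClosed M) : {linear submod A -> M} :=
  (val : submod A -> M).

Lemma mem_sub_val M (A : submodClosed M) (x : submod A) : val x \in A.
Proof. exact: valP. Qed.

Lemma quot_proj_surj M (A : submodClosed M) (q : quotmod A) :
  exists x, quot_proj A x = q.
Proof. by exists (repr q); rewrite /quot_proj reprK. Qed.

Lemma quot_proj_eq0 M (A : submodClosed M) x :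
  (quot_proj A x == 0) = (x \in A).
Proof.
by rewrite -(raddf0 (quot_proj A)) -[_ == _]Quotient.idealrBE subr0.
Qed.

Lemma quot_factor M N (A : submodClosed M) (u : {linear M -> N}) :
  (forall x, x \in A -> u x = 0) ->
  exists v : {linear quotmod A -> N}, forall x, v (quot_proj A x) = u x.
Proof.
move=> uA; have uE x y : quot_proj A x = quot_proj A y -> u x = u y.
  move=> xy; apply/eqP; rewrite -subr_eq0 -linearB; apply/eqP/uA.
  by rewrite -quot_proj_eq0 linearB /= xy subrr.
have [|v vE] := @linear_exists (quotmod A) N (fun q => u (repr q)).
  move=> a p q; rewrite -linearP; apply: uE.
  by rewrite linearP /= /quot_proj !reprK.
by exists v => x; rewrite vE; apply: uE; rewrite /quot_proj reprK.
Qed.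

End Submodules.

(** * Zorn's lemma and Baer's criterion *)

Section Zorn.
Variable K : pzRingType.

(** The single use of Zorn's lemma: a union of a chain of submodules avoiding X
    still avoids X.  Complements, maximal submodules, and maximal extensions or
    lifts of linear maps (through their graphs) are all instances. *)
Lemma max_avoiding (M : lmodType K) (L : submodClosed M) (X : set M) :
  (forall x, x \in L -> ~ X x) ->
  exists N : submodClosed M,
    [/\ forall x, x \in L -> x \in N, forall x, x \in N -> ~ X x &
        forall N' : submodClosed M, (forall x, x \in N -> x \in N') ->
          (forall x, x \in N' -> ~ X x) -> forall x, x \in N' -> x \in N].
Proof.
move=> LX.
(* The empty set is admitted so that the union of the empty chain is. *)
pose P := [set A : set M | A = set0 \/
  [/\ is_submod A, [set` L] `<=` A & forall x, A x -> ~ X x]].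
have [F FP Ftot|A [PA Amax]] := Zorn_bigcup (P := P).
  have [[A0 FA0 A0n]|F0] := pselect (exists2 A, F A & A !=set0); last first.
    left; apply/seteqP; split=> // x [A FA Ax].
    by apply: F0; exists A => //; exists x.
  have FP' A x : F A -> A x ->
      [/\ is_submod A, [set` L] `<=` A & forall x, A x -> ~ X x].
    by move=> FA Ax; have [A_eq|//] := FP _ FA; move: Ax; rewrite A_eq.
  case: A0n => x0 A0x0; right; have [[A00 _ _] LA0 _] := FP' _ _ FA0 A0x0.
  split; last 2 first.
  - by move=> x /LA0 A0x; exists A0.
  - by move=> x [A FA Ax]; have [_ _] := FP' _ _ FA Ax; apply.
  split=> [|x y [A FA Ax] [B FB By]|a x [A FA Ax]]; first by exists A0.
  - have [AB|BA] := Ftot _ _ FA FB.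
      by exists B => //; have [[_ BD _] _ _] := FP' _ _ FB By; apply/BD/By/AB.
    by exists A => //; have [[_ AD _] _ _] := FP' _ _ FA Ax; apply/AD/BA.
  - by exists A => //; have [[_ _ AZ] _ _] := FP' _ _ FA Ax; apply/AZ.
have PL : P [set` L] by right; split=> //; apply: mem_is_submod.
have [A0|[hA LA AX]] := PA.
  by case: (Amax [set` L]) => //; rewrite A0; split=> // /(_ _ (rpred0 L)).
exists (submod_of hA); split=> [x /LA ?|x /submod_ofP/AX//|N' AN' N'X x xN'].
  exact/submod_ofP.
apply/submod_ofP; apply: contrapT => nAx; apply: (Amax [set` N']).
  by split=> [y Ay|/(_ _ xN')]; [apply/AN'/submod_ofP|].
right; split=> //; first exact: mem_is_submod.
by move=> y yL; apply/AN'/submod_ofP/LA.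
Qed.

Lemma disjoint_complement (M : lmodType K) (A : submodClosed M) :
  exists C : submodClosed M, (forall x, x \in A -> x \in C -> x = 0) /\
    forall C' : submodClosed M, (forall x, x \in C -> x \in C') ->
      (forall x, x \in A -> x \in C' -> x = 0) -> forall x, x \in C' -> x \in C.
Proof.
have [|C [_ CX Cmax]] := @max_avoiding M (sub_zero M) [set x | x \in A /\ x <> 0].
  by move=> x /submod_ofP -> [].
exists C; split=> [x xA xC|C' CC' AC'].
  by apply: contrapT => xn0; apply: (CX x).
by apply: Cmax => // x xC' [xA]; apply; apply: AC'.
Qed.

(** M/L is cyclic, generated by the class of q; a submodule containing L that is
    maximal for not containing q is then a maximal submodule. *)
Lemma exists_maximal_submodule (M : lmodType K) (L : submodClosed M) (q : M) :
  (forall x, exists a l, l \in L /\ x = a *: q + l) -> q \notin L ->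
  exists2 N : submodClosed M, maximal_submodule N & q \notin N.
Proof.
move=> Lq qL.
have [|N [LN Nq Nmax]] := @max_avoiding M L [set q].
  by move=> x xL xq; move: qL; rewrite -xq xL.
have {}Nq : q \notin N by apply/negP => /Nq; apply.
exists N => //; split; first by apply/proper_submoduleP; exists q.
move=> N' NN' /proper_submoduleP[x xN']; apply/seteqP; split=> //= y.
apply: Nmax => // z zN' zq; case/negP: xN'; have [a [l [lL ->]]] := Lq x.
by rewrite -[q]zq rpredD ?rpredZ//; apply/NN'/LN.
Qed.

End Zorn.

Section Baer.
Variable K : pzRingType.

Definition baer (E : lmodType K) : Prop :=
  forall (I : submodClosed K^o) (f : {linear submod I -> E}),
    exists y : E, forall i, f i = (val i : K) *: y.

Lemma injective_baer E : injective_module E -> baer E.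
Proof.
move=> Einj I f.
have [|h fh] := Einj _ _ (sub_val I) f; first exact: val_inj.
exists (h 1) => i; rewrite fh /= -linearZ /=; congr (h _).
exact: (esym (mulr1 _)).
Qed.

(** Take a maximal single-valued relation containing G.  If n is outside its
    domain, the partial map [r |-> value at r n] is defined on an ideal, hence
    is multiplication by some y0, and adjoining (n, y0) keeps the relation
    single-valued. *)
Lemma baer_extension (M E : lmodType K) (G : submodClosed (M * E)%type) :
  baer E -> functional_rel G ->
  exists h : {linear M -> E}, forall x y, (x, y) \in G -> h x = y.
Proof.
move=> Eb Gf.
have [|H [GH HX Hmax]] :=
    @max_avoiding K (M * E)%type G [set z | z.1 = 0 /\ z.2 <> 0].
  by move=> [x y] xyG /= [x0]; apply; apply: Gf; rewrite -x0.
have Hf : functional_rel H.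
  by move=> y yH; apply: contrapT => yn0; apply: (HX _ yH).
have [|h hH] := linear_of_rel Hf; last first.
  exists h => x y xyG; exact: functional_rel_uniq Hf (hH x) (GH _ xyG).
move=> n.
(* I is the set of coefficients r for which r n already lies in the domain. *)
have hI : is_submod [set r : K^o | exists y, ((r : K) *: n, y) \in H].
  split=> [|r s [y ry] [z sz]|a r [y ry]].
  - by exists 0; rewrite scale0r rpred0.
  - exists (y + z); rewrite scalerDl.
    by rewrite -[(_, _)]/((r *: n, y) + (s *: n, z)) rpredD.
  - exists (a *: y); rewrite -scalerA.
    by rewrite -[(_, _)]/(a *: ((r : K) *: n, y)) rpredZ.
have [|f fH] := @choice (submod (submod_of hI)) E
    (fun r y => ((val r : K) *: n, y) \in H).
  by move=> r; by have /submod_ofP := mem_sub_val r.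
have [|f' f'E] := @linear_exists K (submod (submod_of hI)) E f.
  move=> a r s; apply: (functional_rel_uniq Hf (fH _)).
  rewrite linearP /= scalerDl -scalerA.
  rewrite -[(_, _)]/(a *: ((val r : K) *: n, f r) + ((val s : K) *: n, f s)).
  by rewrite rpredD ?rpredZ.
have [y0 y0P] := Eb _ f'.
pose H' := sub_sum H (sub_cyclic ((n, y0) : (M * E)%type)).
exists y0; apply: (Hmax H').
- by move=> z; apply: sub_suml.
- move=> z /sub_sumP[[u v] [_ [uvH /sub_cyclicP[r ->] ->]]] /= [u0]; apply.
  have unr : u = (- r) *: n by apply/eqP; rewrite scaleNr -addr_eq0; apply/eqP.
  have rI : (- r : K^o) \in submod_of hI.
    by apply/submod_ofP; exists v; rewrite -unr.
  have := y0P (Sub (- r : K^o) rI); rewrite f'E /=.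
  have := fH (Sub (- r : K^o) rI); rewrite /= -unr => H1 H2.
  by rewrite (functional_rel_uniq Hf uvH H1) H2 scaleNr addNr.
- exact/sub_sumr/mem_sub_cyclic.
Qed.

Lemma baer_injective E : baer E -> injective_module E.
Proof.
move=> Eb M N f g finj.
have hG : is_submod [set z : (N * E)%type | exists x, z = (f x, g x)].
  split=> [|_ _ [x ->] [y ->]|a _ [x ->]].
  - by exists 0; rewrite !raddf0.
  - by exists (x + y); rewrite !raddfD.
  - by exists (a *: x); rewrite !linearZ.
have [//||h hG'] := @baer_extension N E (submod_of hG).
  move=> y /submod_ofP[x [fx ->]].
  by have -> : x = 0; [apply: finj; rewrite -fx raddf0|rewrite raddf0].
by exists h => x /=; apply/esym/hG'/submod_ofP; exists x.
Qed.

End Baer.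

(** * Lifting, retracts and complements *)

Section Retracts.
Variable K : pzRingType.
Implicit Types M N E P : lmodType K.

Definition hereditary : Prop :=
  forall I : submodClosed K^o, projective_module (submod I).

Definition surjective (A B : Type) (u : A -> B) : Prop := forall y, exists x, u x = y.

Lemma surjective_range (A B : Type) (u : A -> B) : surjective u -> range u = setT.
Proof. by move=> us; apply/seteqP; split=> // y _; have [x <-] := us y; exists x. Qed.

(** Corestrict both maps to the range of f, which contains that of g. *)
Lemma projective_lift P M N (f : {linear M -> N}) (g : {linear P -> N}) :
  projective_module P -> (forall p, exists m, f m = g p) ->
  exists h : {linear P -> M}, forall p, f (h p) = g p.
Proof.
move=> Pproj fg.
have [|f' f'E] := @lift_sub _ _ _ (sub_range f) f.
  by move=> x; apply/submod_ofP; exists x.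
have [|g' g'E] := @lift_sub _ _ _ (sub_range f) g.
  by move=> p; apply/submod_ofP; have [m <-] := fg p; exists m.
have [|h hE] := Pproj _ _ f' g'.
  apply: surjective_range => -[y yf]; have /submod_ofP[x _ xy] := yf.
  by exists x; apply: val_inj; rewrite f'E.
by exists h => p; rewrite -g'E hE /= f'E.
Qed.

Lemma free_projective : projective_module K^o.
Proof.
move=> M N f g fs; have [m _ fm] : range f (g 1) by rewrite fs.
have [|h hE] := @linear_exists K K^o M (fun a => (a : K) *: m).
  by move=> a x y; rewrite scalerDl scalerA.
by exists h => a /=; rewrite hE linearZ fm -linearZ /=; congr (g _); apply/esym/mulr1.
Qed.

(** A map from an ideal I to M lifts to E since I is projective; there it is
    multiplication by some y, so in M it is multiplication by [u y]. *)
Lemma hereditary_quotient E M (u : {linear E -> M}) :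
  hereditary -> injective_module E -> surjective u -> injective_module M.
Proof.
move=> hered Einj us; apply: baer_injective => I f.
have [h hE] := projective_lift (hered I) (fun p => us (f p)).
by have [y yE] := injective_baer Einj h; exists (u y) => i; rewrite -hE yE linearZ.
Qed.

Lemma injective_retraction M N (s : {linear N -> M}) :
  injective_module N -> injective s ->
  exists p : {linear M -> N}, cancel s p.
Proof.
by move=> Ninj /(Ninj _ _ s idfun)[p pE]; exists p => x; rewrite -[LHS]pE.
Qed.

Lemma injective_retract M N (s : {linear N -> M}) (p : {linear M -> N}) :
  cancel s p -> injective_module M -> injective_module N.
Proof.
move=> sK Minj A B f g finj; have [h hE] := Minj _ _ f (s \o g) finj.
by exists (p \o h) => x /=; rewrite -[h _]/((h \o f) x) -hE /= sK.
Qed.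

Lemma projective_retract M N (s : {linear N -> M}) (p : {linear M -> N}) :
  cancel s p -> projective_module M -> projective_module N.
Proof.
move=> sK Mproj A B f g fs; have [h hE] := Mproj _ _ f (g \o p) fs.
by exists (h \o s) => x; rewrite /= -[RHS]/((f \o h) (s x)) -hE /= sK.
Qed.

Lemma projective_section P M (u : {linear M -> P}) :
  projective_module P -> surjective u -> exists s : {linear P -> M}, cancel s u.
Proof.
by move=> Pproj us; apply: (projective_lift (g := idfun) Pproj) => p; exact: us.
Qed.

Lemma direct_sum_projection M (A B : submodClosed M) :
  internal_direct_sum A B ->
  exists p : {linear M -> submod A},
    [/\ cancel val p, forall b, b \in B -> p b = 0 & forall x, x - val (p x) \in B].
Proof.
move=> /internal_direct_sumP[AB cap].
have hG : is_submod [set z : (M * submod A)%type | z.1 - val z.2 \in B].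
  split=> [|[x y] [z t] /= xy zt|a [x y] /= xy]; rewrite /= ?raddf0 ?addr0 ?rpred0 //.
  - by rewrite raddfD /= addrACA rpredD.
  - by rewrite linearZ /= -?scalerBr -?scalerDr rpredZ.
have [||p pG] := @linear_of_rel K M (submod A) (submod_of hG).
- move=> y /submod_ofP /= yB; apply/val_inj/cap; first exact: mem_sub_val.
  by rewrite -[val y]opprK submodN // -sub0r.
- move=> x; have [a [b [aA bB ->]]] := AB x; exists (Sub a aA).
  by apply/submod_ofP; rewrite /= addrC addKr.
have pB x : x - val (p x) \in B by have /submod_ofP := pG x.
exists p; split=> // [a|b bB].
- apply/val_inj/eqP; rewrite eq_sym -subr_eq0; apply/eqP/cap => //.
  by rewrite submodB ?mem_sub_val.
- apply/val_inj/cap; first exact: mem_sub_val.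
  by rewrite -[val _](subKr b) submodB.
Qed.

Lemma retraction_direct_sum M (B : submodClosed M)
    (p : {linear M -> submod B}) :
  cancel val p -> internal_direct_sum (sub_ker p) B.
Proof.
move=> pK; apply/internal_direct_sumP; split=> [x|x /submod_ofP px xB].
- exists (x - val (p x)), (val (p x)); rewrite subrK mem_sub_val; split=> //.
  by apply/submod_ofP; rewrite /= linearB /= pK subrr.
- by have := pK (Sub x xB); rewrite /= px => /(congr1 val).
Qed.

Lemma injective_summand M (A B : submodClosed M) :
  internal_direct_sum A B -> injective_module M -> injective_module (submod A).
Proof.
move=> /direct_sum_projection[p [pK _ _]]; apply: (injective_retract (s := sub_val A)).
exact: pK.
Qed.

Lemma linear_inverse M N (u : {linear M -> N}) :
  injective u -> surjective u ->
  exists v : {linear N -> M}, cancel v u.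
Proof.
move=> ui us; have [v vE] := choice us.
have [|v' v'E] := @linear_exists K N M v.
  by move=> a x y; apply: ui; rewrite linearP !vE.
by exists v' => y; rewrite v'E vE.
Qed.

Lemma semisimple_quotient M N (u : {linear M -> N}) :
  semisimple_module M -> surjective u -> semisimple_module N.
Proof.
move=> Mss us A; have [C /internal_direct_sumP[AC cap]] := Mss (sub_preim u A).
exists (sub_range (u \o sub_val C)); apply/internal_direct_sumP; split=> [x|x xA].
- have [y <-] := us x; have [a [c [/submod_ofP aA cC ->]]] := AC y.
  exists (u a), (u c); rewrite raddfD; split=> //.
  by apply/submod_ofP; exists (Sub c cC).
- move=> /submod_ofP[c _ cx]; rewrite -cx /= (cap (val c)) ?raddf0 ?mem_sub_val //.
  by apply/submod_ofP; move: xA; rewrite -cx.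
Qed.

Lemma semisimple_section M N (u : {linear M -> N}) :
  semisimple_module M -> surjective u -> exists s : {linear N -> M}, cancel s u.
Proof.
move=> Mss us; have [C /internal_direct_sumP[kC cap]] := Mss (sub_ker u).
have hG : is_submod [set z : (N * M)%type | u z.2 = z.1 /\ z.2 \in C].
  split=> [|[x y] [z t] /= [<- yC] [<- tC]|a [x y] /= [<- yC]] /=.
  - by rewrite raddf0 rpred0.
  - by rewrite raddfD rpredD.
  - by rewrite linearZ rpredZ.
have [||s sG] := @linear_of_rel K N M (submod_of hG).
- by move=> y /submod_ofP[/= uy yC]; apply: cap => //; apply/submod_ofP.
- move=> x; have [y <-] := us x; have [a [c [/submod_ofP /= ua cC ->]]] := kC y.
  by exists c; apply/submod_ofP; rewrite /= raddfD /= ua add0r.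
by exists s => x; have /submod_ofP[] := sG x.
Qed.

(** A submodule A of the product is an extension of its first projection by its
    intersection with the second factor; complements of these two, taken in M and N,
    multiply to a complement of A. *)
Lemma semisimple_prod M N :
  semisimple_module M -> semisimple_module N -> semisimple_module (M * N)%type.
Proof.
move=> Mss Nss A.
have hA2 : is_submod [set y : N | (0, y) \in A].
  split=> [|y z yA zA|a y yA]; first exact: rpred0.
  - by rewrite /= -(addr0 0) -[(_, _)]/((0, y) + (0, z)) rpredD.
  - by rewrite /= -(scaler0 _ a) -[(_, _)]/(a *: (0, y)) rpredZ.
have hA1 : is_submod [set x : M | exists y, (x, y) \in A].
  split=> [|x z [y yA] [t tA]|a x [y yA]]; first by exists 0; apply: rpred0.
  - by exists (y + t); rewrite -[(_, _)]/((x, y) + (z, t)) rpredD.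
  - by exists (a *: y); rewrite -[(_, _)]/(a *: (x, y)) rpredZ.
have [C1 /internal_direct_sumP[AC1 cap1]] := Mss (submod_of hA1).
have [C2 /internal_direct_sumP[AC2 cap2]] := Nss (submod_of hA2).
have hC : is_submod [set z : (M * N)%type | z.1 \in C1 /\ z.2 \in C2].
  split=> [|x y [? ?] [? ?]|a x [? ?]]; first by rewrite /= !rpred0.
  - by rewrite /= !rpredD.
  - by rewrite /= !rpredZ.
exists (submod_of hC); apply/internal_direct_sumP; split=> [[x y]|[x y] xyA].
- have [a1 [c1 [/submod_ofP[a2 aA] c1C ->]]] := AC1 x.
  have [b2 [c2 [/submod_ofP bA c2C yE]]] := AC2 (y - a2).
  exists ((a1, a2) + (0, b2)), (c1, c2); split; first exact: rpredD.
    exact/submod_ofP.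
  by congr (_, _); rewrite /= ?addr0 // -addrA -yE addrC subrK.
- move=> /submod_ofP[/= xC yC]; have x0 : x = 0.
    by apply: cap1 => //; apply/submod_ofP; exists y.
  by congr (_, _) => //; apply: cap2 => //; apply/submod_ofP; rewrite /= -x0.
Qed.

(** ** Injective projective semisimple modules *)

Definition ips_module M : Prop :=
  [/\ injective_module M, projective_module M & semisimple_module M].

(** A quotient of a semisimple module is a retract of it, and all three
    properties pass to retracts. *)
Lemma ips_quotient M N (u : {linear M -> N}) :
  ips_module M -> surjective u -> ips_module N.
Proof.
move=> [Minj Mproj Mss] us; have [s sK] := semisimple_section Mss us.
split; [exact: injective_retract sK _|exact: projective_retract sK _|].
exact: semisimple_quotient us.
Qed.

Lemma injective_prod M N :
  injective_module M -> injective_module N -> injective_module (M * N)%type.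
Proof.
move=> Minj Ninj A B f g finj.
have [h1 h1E] := Minj _ _ f (fst \o g) finj.
have [h2 h2E] := Ninj _ _ f (snd \o g) finj.
have [|h hE] := @linear_exists K B (M * N)%type (fun b => (h1 b, h2 b)).
  by move=> a x y; rewrite !linearP.
exists h => x; rewrite /= hE -[h1 _]/((h1 \o f) x) -[h2 _]/((h2 \o f) x) -h1E -h2E.
by rewrite /=; case: (g x).
Qed.

Lemma projective_prod M N :
  projective_module M -> projective_module N -> projective_module (M * N)%type.
Proof.
move=> Mproj Nproj A B f g fs.
have [|i1 i1E] := @linear_exists K M (M * N)%type (fun x => (x, 0)).
  by move=> a x y; rewrite -[RHS]/(a *: x + y, a *: 0 + 0) scaler0 addr0.
have [|i2 i2E] := @linear_exists K N (M * N)%type (fun x => (0, x)).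
  by move=> a x y; rewrite -[RHS]/(a *: 0 + 0, a *: x + y) scaler0 addr0.
have [h1 h1E] := Mproj _ _ f (g \o i1) fs.
have [h2 h2E] := Nproj _ _ f (g \o i2) fs.
have [|h hE] := @linear_exists K (M * N)%type A (fun z => h1 z.1 + h2 z.2).
  by move=> a x y; rewrite !linearP scalerDr addrACA.
exists h => -[x y] /=; rewrite hE raddfD /= -[f (h1 x)]/((f \o h1) x).
rewrite -[f (h2 y)]/((f \o h2) y) -h1E -h2E /= i1E i2E -raddfD.
by congr (g _); congr (_, _); rewrite ?addr0 ?add0r.
Qed.

Lemma ips_prod M N : ips_module M -> ips_module N -> ips_module (M * N)%type.
Proof.
move=> [Mi Mp Ms] [Ni Np Ns].
by split; [apply: injective_prod|apply: projective_prod|apply: semisimple_prod].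
Qed.

Lemma ips_sub M (N : submodClosed M) : ips_module M -> ips_module (submod N).
Proof.
move=> Mips; have [_ _ Mss] := Mips.
have [C /direct_sum_projection[p [pK _ _]]] := Mss N.
by apply: (ips_quotient (u := p)) => // x; exists (val x).
Qed.

Lemma ips_range M N (u : {linear M -> N}) :
  ips_module M -> ips_module (submod (sub_range u)).
Proof.
move=> Mips; have [|v vE] := @lift_sub _ _ _ (sub_range u) u.
  by move=> x; apply/submod_ofP; exists x.
apply: (ips_quotient (u := v)) => // -[y yu]; have /submod_ofP[x _ xy] := yu.
by exists x; apply: val_inj; rewrite vE.
Qed.

End Retracts.

(** * The trace of the injective projective semisimple modules *)

Section Trace.
Variable K : pzRingType.
Implicit Types M N E P G : lmodType K.

Definition noetherian : Prop :=
  forall I : nat -> submodClosed K^o,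
    (forall n, [set` I n] `<=` [set` I n.+1]) ->
    exists n, forall m, (n <= m)%N -> [set` I m] = [set` I n].

(** Otherwise every member of F has a strictly larger one, and iterating a
    choice of larger members contradicts the ascending chain condition. *)
Lemma noetherian_maximal (F : set (submodClosed K^o)) : noetherian -> F !=set0 ->
  exists I, F I /\
    forall J, F J -> (forall x, x \in I -> x \in J) -> forall x, x \in J -> x \in I.
Proof.
move=> noeth [I0 FI0]; apply: contrapT => nmax.
pose T := {I | F I}.
have step (I : T) : exists J : T, (forall x, x \in sval I -> x \in sval J) /\
    ~ (forall x, x \in sval J -> x \in sval I).
  case: I => I FI; apply: contrapT => nJ; apply: nmax; exists I; split=> // J FJ IJ.
  by apply: contrapT => JI; apply: nJ; exists (exist _ J FJ).
have [f fP] := choice step.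
pose I n := sval (iter n f (exist _ I0 FI0)).
have [n In] : exists n, forall m, (n <= m)%N -> [set` I m] = [set` I n].
  by apply: noeth => n x /=; apply: (fP _).1.
apply: (fP (iter n f (exist _ I0 FI0))).2 => x.
have /eq_submodP E := In n.+1 (leqnSn n).
by rewrite -[_ \in _]/(x \in I n.+1) E.
Qed.

Lemma ips_pair M G1 G2 (u1 : {linear G1 -> M}) (u2 : {linear G2 -> M}) :
  ips_module G1 -> ips_module G2 ->
  exists G (u : {linear G -> M}), ips_module G /\
    forall y1 y2, exists y, u y = u1 y1 + u2 y2.
Proof.
move=> G1ips G2ips; exists (G1 * G2)%type.
have [|u uE] := @linear_exists K (G1 * G2)%type M (fun z => u1 z.1 + u2 z.2).
  by move=> a x y; rewrite !linearP scalerDr addrACA.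
by exists u; split=> [|y1 y2]; [apply: ips_prod|exists (y1, y2); rewrite uE].
Qed.

Definition ips_trace M : set M :=
  [set x | exists G (u : {linear G -> M}) y, ips_module G /\ u y = x].

Lemma ips_trace_sub M (A : submodClosed M) x :
  ips_module (submod A) -> x \in A -> ips_trace x.
Proof. by move=> Aips xA; exists (submod A), (sub_val A), (Sub x xA). Qed.

Lemma ips_traceE M x : @ips_trace M x ->
  exists A : submodClosed M, ips_module (submod A) /\ x \in A.
Proof.
move=> [G [u [y [Gips <-]]]]; exists (sub_range u); split; first exact: ips_range.
by apply/submod_ofP; exists y.
Qed.

Lemma ips_trace_map M N (u : {linear M -> N}) x : ips_trace x -> ips_trace (u x).
Proof. by move=> [G [v [y [Gips <-]]]]; exists G, (u \o v), y. Qed.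

(** If [u n] comes from g in a module G of the class, the cyclic submodule
    generated by g is again in the class, hence projective, and it is mapped
    into the range of u; so it lifts to N. *)
Lemma ips_trace_reflect N M (u : {linear N -> M}) n :
  ips_trace (u n) -> exists2 c, ips_trace c & u c = u n.
Proof.
move=> [G [v [g [Gips vg]]]].
have G'ips := ips_sub (sub_cyclic g) Gips; have [_ G'proj _] := G'ips.
have [|w wE] := projective_lift (f := u) (g := v \o sub_val (sub_cyclic g)) G'proj.
  move=> x; have /sub_cyclicP[a xE] := mem_sub_val x.
  by exists (a *: n); rewrite /= [val x]xE !linearZ /= vg.
pose g' : submod (sub_cyclic g) := Sub g (mem_sub_cyclic g).
by exists (w g'); [exists (submod (sub_cyclic g)), w, g'|rewrite wE].
Qed.

Fact ips_trace_is_submod M : is_submod (@ips_trace M).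
Proof.
split=> [|x1 x2 [G1 [u1 [y1 [G1ips <-]]]] [G2 [u2 [y2 [G2ips <-]]]]|a x].
- exists (submod (sub_zero M)), (sub_val _), 0; split; last exact: raddf0.
  have z0 (z : submod (sub_zero M)) : z = 0.
    by apply: val_inj; have /submod_ofP := mem_sub_val z.
  split=> [A B f g _|A B f g fs|A].
  + by exists \0 => x; rewrite [LHS]z0 [RHS]z0.
  + by exists \0 => x; rewrite [x]z0 !raddf0.
  + exists A; apply/internal_direct_sumP; split=> [x|x _ _]; last exact: z0.
    by exists 0, 0; rewrite rpred0 [x]z0 addr0.
- have [G [u [Gips uP]]] := ips_pair u1 u2 G1ips G2ips.
  by have [y yE] := uP y1 y2; exists G, u, y.
- move=> [G [u [y [Gips <-]]]]; exists G, u, (a *: y).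
  by rewrite linearZ.
Qed.

Definition sub_ips_trace M := submod_of (ips_trace_is_submod M).

Lemma ips_trace_idem M (x : submod (sub_ips_trace M)) : ips_trace x.
Proof.
have /submod_ofP /ips_traceE[A [Aips xA]] := mem_sub_val x.
have [|v vE] := @lift_sub _ _ _ (sub_ips_trace M) (sub_val A).
  by move=> a; apply/submod_ofP/(ips_trace_sub Aips)/mem_sub_val.
by exists (submod A), v, (Sub (val x) xA); split=> //; apply: val_inj; rewrite vE.
Qed.

(** Baer's criterion.  Given a map f from an ideal I, consider the ideals J on
    which f has values in the image of one module of the class.  A maximal such
    J contains I, as the module used for J and the one used for a further
    element of I combine into their product.  So f has values in an injective
    submodule. *)
Lemma ips_trace_injective M :
  noetherian -> injective_module (submod (sub_ips_trace M)).
Proof.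
move=> noeth; apply: baer_injective => I f.
pose F := [set J : submodClosed K^o | exists G (u : {linear G -> M}),
  ips_module G /\ forall i, val i \in J -> exists y, u y = val (f i)].
have [|J [[G [u [Gips uP]]] Jmax]] := @noetherian_maximal F noeth.
  have /ips_traceE[A [Aips _]] : ips_trace (0 : M).
    by have [] := ips_trace_is_submod M.
  exists (sub_zero K^o), (submod A), (sub_val A); split=> // i /submod_ofP i0.
  by exists 0; have -> : i = 0 by [apply: val_inj]; rewrite !raddf0.
have uI i : exists y, u y = val (f i).
  apply: (uP); have /submod_ofP[G' [u' [y' [G'ips y'E]]]] := mem_sub_val (f i).
  have [H [v [Hips vP]]] := ips_pair u u' Gips G'ips.
  apply: (Jmax (sub_sum J (sub_cyclic (val i)))) => [|x|].
  - exists H, v; split=> // j /sub_sumP[j0 [_ [j0J /sub_cyclicP[a ->] jE]]].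
    have jE' : val (j - a *: i) = j0 by rewrite -[LHS]/(val j - a *: val i) jE addrK.
    have [|y yE] := uP (j - a *: i); first by rewrite jE'.
    have [z zE] := vP y (a *: y').
    exists z; rewrite zE yE [u' _]linearZ /= y'E; pose g : {linear submod I -> M} := sub_val _ \o f.
    by rewrite -[LHS]/(g (j - a *: i) + a *: g i) -[RHS]/(g j) linearB linearZ subrK.
  - exact: sub_suml.
  - exact/sub_sumr/mem_sub_cyclic.
have [Rinj _ _] := ips_range u Gips.
have [|f' f'E] := @lift_sub _ _ _ (sub_range u) (sub_val _ \o f).
  by move=> i; apply/submod_ofP; have [y yE] := uI i; exists y.
have [y yE] := injective_baer Rinj f'.
have yB : val y \in sub_ips_trace M.
  by apply/submod_ofP/(ips_trace_sub (ips_range u Gips))/mem_sub_val.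
exists (Sub (val y) yB) => i; apply: val_inj.
by rewrite -[LHS](f'E i) yE.
Qed.

(** Let C be a maximal submodule meeting A in 0, and x in a submodule B of the
    class.  A complement in B of the part of B inside A + C can be added to C,
    so it is contained in C and x is in A + C. *)
Lemma ips_generated_semisimple M : (forall x : M, ips_trace x) -> semisimple_module M.
Proof.
move=> gen A; have [C [AC Cmax]] := disjoint_complement A.
exists C; apply/internal_direct_sumP; split=> // x; apply/sub_sumP.
have [B [[_ _ Bss] xB]] := ips_traceE (gen x).
have [D /internal_direct_sumP[BD cap]] := Bss (sub_preim (sub_val B) (sub_sum A C)).
have [b [d [/submod_ofP /= bAC dD xE]]] := BD (Sub x xB).
have -> : x = val b + val d by rewrite -raddfD -xE.
rewrite rpredD // sub_sumr //.
pose D' := sub_range (sub_val B \o sub_val D).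
apply: (Cmax (sub_sum C D')); first by move=> y; apply: sub_suml.
  move=> a aA /sub_sumP[c [_ [cC /submod_ofP[e _ <-] aE]]].
  have e0 : val e = 0.
    apply: cap (mem_sub_val e); apply/submod_ofP/sub_sumP; exists a, (- c).
    by split; rewrite ?submodN // aE addrAC subrr add0r.
  by move: aE; rewrite /= e0 addr0 => aE; apply: AC => //; rewrite aE.
by apply/sub_sumr/submod_ofP; exists (Sub d dD).
Qed.

(** A maximal partial lift is total: for x in a submodule B of the class, a
    complement in B of the part where the lift is defined can be mapped through
    a lift on the whole of B, which exists as B is projective. *)
Lemma ips_generated_projective M : (forall x : M, ips_trace x) -> projective_module M.
Proof.
move=> gen X Y f g fs.
have fE y : exists x, f x = y by have [x _ <-] : range f y; [rewrite fs|exists x].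
(* Partial lifts of g through f, seen as graphs. *)
have [|H [_ HX Hmax]] := @max_avoiding K (M * X)%type (sub_zero _)
  [set z | f z.2 <> g z.1 \/ (z.1 = 0 /\ z.2 <> 0)].
  by move=> x /submod_ofP -> /= []; [rewrite !raddf0|case].
have Hf : functional_rel H.
  by move=> y yH; apply: contrapT => yn0; apply: (HX _ yH); right.
have HE z : z \in H -> f z.2 = g z.1.
  by move=> zH; apply: contrapT => zn; apply: (HX z zH); left.
have [|h hH] := linear_of_rel Hf; last by exists h => x; rewrite -(HE _ (hH x)).
move=> x; have [B [[_ Bproj Bss] xB]] := ips_traceE (gen x).
have [l lE] := projective_lift (f := f) (g := g \o sub_val B) Bproj (fun b => fE _).
have hdom : is_submod [set b : submod B | exists y, (val b, y) \in H].
  split=> [|b c [y yH] [t tH]|a b [y yH]].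
  - by exists 0; rewrite raddf0; apply: rpred0.
  - by exists (y + t); rewrite raddfD -[(_, _)]/((val b, y) + (val c, t)) rpredD.
  - by exists (a *: y); rewrite linearZ -[(_, _)]/(a *: (val b, y)) rpredZ.
have [D /internal_direct_sumP[BD cap]] := Bss (submod_of hdom).
have hG : is_submod [set z : (M * X)%type | exists2 d, d \in D & z = (val d, l d)].
  split=> [|_ _ [b bD ->] [c cD ->]|a _ [b bD ->]].
  - by exists 0; rewrite ?rpred0 ?raddf0.
  - by exists (b + c); rewrite ?rpredD // !raddfD.
  - by exists (a *: b); rewrite ?rpredZ // !linearZ.
have [b [d [/submod_ofP[y byH] dD xE]]] := BD (Sub x xB).
exists (y + l d).
have -> : (x, y + l d) = (val b, y) + (val d, l d).
  by congr (_, _); rewrite -[RHS]/(val (b + d)) -xE.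
rewrite rpredD //; apply: (Hmax (sub_sum H (submod_of hG))).
- by move=> z; apply: sub_suml.
- move=> z /sub_sumP[[z1 z2] [_ [zH /submod_ofP[e eD ->] ->]]] /= [|[z1e]]; apply.
    by have /= zE := HE _ zH; rewrite !raddfD /= zE lE.
  have e0 : e = 0.
    apply: cap => //; apply/submod_ofP; exists (- z2).
    have -> : val e = - z1 by apply/eqP; rewrite -addr_eq0 addrC z1e.
    exact: (submodN zH).
  move: z1e; rewrite e0 !raddf0 !addr0 => z10; apply: Hf.
  by move: zH; rewrite z10.
- by apply/sub_sumr/submod_ofP; exists d.
Qed.

Lemma ips_trace_ips M : noetherian -> ips_module (submod (sub_ips_trace M)).
Proof.
move=> noeth; split; first exact: ips_trace_injective.
- by apply: ips_generated_projective => x; apply: ips_trace_idem.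
- by apply: ips_generated_semisimple => x; apply: ips_trace_idem.
Qed.

End Trace.

(** * Max-QF rings and the radical of an injective module *)

Section RadicalDecomposition.

Lemma maximal_submodule_sum (K : pzRingType) (M : lmodType K) (N L : submodClosed M) :
  maximal_submodule N -> (forall x, x \in N -> x \in L) ->
  (exists2 x, x \in L & x \notin N) -> forall x, x \in L.
Proof.
move=> [_ Nmax] NL [x xL xN] y; apply: contrapT => /negP yL.
have Lproper : proper_submodule L by apply/proper_submoduleP; exists y.
by case/negP: xN; have /eq_submodP <- := Nmax L NL Lproper.
Qed.

Variable R : pzRingType.
Local Notation K := (R^c).

(** The simple module E/N is a quotient of an injective module, hence injective,
    and it is isomorphic to K/I for a maximal ideal I.  Applying
    max-projectivity to E/N itself, the isomorphism lifts to K, so E/N is a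
    retract of K and is projective.  Now E/N is in the class and has a section
    in E, whose nonzero values are outside N. *)
Lemma max_QF_trace_maximal (E : lmodType K) (N : submodClosed E) :
  hereditary K -> right_max_QF R -> injective_module E -> maximal_submodule N ->
  exists2 t, ips_trace t & t \notin N.
Proof.
move=> hered mQF Einj Nmax.
have [x xN] : exists x, x \notin N by apply/proper_submoduleP/Nmax.1.
have gen y : y \notin N -> forall z, exists a n, n \in N /\ z = n + a *: y.
  move=> yN z; have [n [_ [nN /sub_cyclicP[a ->] ->]]] :
      exists n c, [/\ n \in N, c \in sub_cyclic y & z = n + c].
    apply/sub_sumP; apply: (maximal_submodule_sum Nmax).
      by move=> w; apply: sub_suml.
    by exists y => //; apply/sub_sumr/mem_sub_cyclic.
  by exists a, n.
(* The kernel of u : a |-> a x + N is the ideal I. *)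
have [|u uE] := @linear_exists K K^o (quotmod N)
    (fun a => (a : K) *: quot_proj N x).
  by move=> a b c; rewrite scalerDl scalerA.
have us : surjective u.
  move=> q; have [z <-] := quot_proj_surj q; have [a [n [nN ->]]] := gen x xN z.
  exists a; rewrite uE linearD linearZ /=.
  by move: nN; rewrite -quot_proj_eq0 => /eqP ->; rewrite add0r.
have u0 a : u a = 0 -> (a : K) *: x \in N.
  by rewrite uE -linearZ => /eqP; rewrite quot_proj_eq0.
have Imax : maximal_submodule (sub_ker u).
  split.
    apply/proper_submoduleP; exists 1; apply/negP => /submod_ofP/u0.
    by rewrite scale1r (negbTE xN).
  move=> L IL /proper_submoduleP[c cL]; apply/seteqP; split=> // a /= aL.
  apply/submod_ofP => /=; rewrite uE -linearZ /=; apply/eqP; rewrite quot_proj_eq0.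
  apply: contrapT => /negP axN; case/negP: cL.
  have [b [n [nN xE]]] := gen _ axN x.
  (* 1 is in L: if x = n + b (a x) with n in N, then 1 - b a is in I. *)
  have -> : c = (c : K) *: (((1 : K) - (b : K) *: (a : K^o)) + (b : K) *: (a : K^o) : K^o).
    by rewrite subrK; apply/esym/mulr1.
  rewrite rpredZ // rpredD ?rpredZ //; apply: IL; apply/submod_ofP => /=.
  rewrite uE -linearZ /=; apply/eqP; rewrite quot_proj_eq0 scalerBl scale1r.
  by rewrite -scalerA {1}xE addrK.
have [|v vE] := @quot_factor _ _ _ (sub_ker u) u.
  by move=> a /submod_ofP.
have [||w wK] := @linear_inverse _ _ _ v.
- move=> p q; have [a <-] := quot_proj_surj p; have [b <-] := quot_proj_surj q.
  rewrite !vE => uab; apply/eqP; rewrite -subr_eq0 -linearB quot_proj_eq0.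
  by apply/submod_ofP; rewrite /= linearB /= uab subrr.
- by move=> q; have [a <-] := us q; exists (quot_proj _ a).
have Qinj : injective_module (quotmod N).
  exact: (hereditary_quotient (u := quot_proj N)) (@quot_proj_surj _ _ _).
have [g gE] := mQF _ Qinj _ Imax w.
have gK : cancel g u by move=> q; rewrite -vE -[quot_proj _ _]/((quot_proj _ \o g) q) -gE wK.
have Qproj : projective_module (quotmod N).
  exact: projective_retract gK (@free_projective K).
have Qss : semisimple_module (quotmod N).
  move=> A; have [A0|/existsNP[q /not_implyP[qA /eqP q0]]] :=
    pselect (forall q, q \in A -> q = 0).
    exists (sub_full _); apply/internal_direct_sumP; split=> [q|q /A0 //].
    by exists 0, q; rewrite rpred0 add0r; split=> //; apply/submod_ofP.
  exists (sub_zero _); apply/internal_direct_sumP; split=> [p|p _ /submod_ofP//].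
  exists p, 0; rewrite rpred0 addr0; split=> //.
  have [z <-] := quot_proj_surj p.
  suff /submod_ofP : z \in sub_preim (quot_proj N) A by [].
  apply: (maximal_submodule_sum Nmax) => [y yN|].
    by apply/submod_ofP; move: yN; rewrite /= -quot_proj_eq0 => /eqP ->; apply: rpred0.
  have [y yq] := quot_proj_surj q; exists y; first by apply/submod_ofP; rewrite /= yq.
  by rewrite -quot_proj_eq0 yq.
have [s sK] := projective_section Qproj (@quot_proj_surj _ _ N).
exists (s (quot_proj N x)); first by exists (quotmod N), s, (quot_proj N x).
by rewrite -quot_proj_eq0 sK quot_proj_eq0.
Qed.

Lemma max_QF_decomposition (E : lmodType K) :
  hereditary K -> noetherian K -> right_max_QF R -> injective_module E ->
  exists A B : submodClosed E,
    [/\ internal_direct_sum A B, Rad (submod A) = setT,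
        projective_module (submod B) & semisimple_module (submod B)].
Proof.
move=> hered noeth mQF Einj.
have [Binj Bproj Bss] := @ips_trace_ips K E noeth.
have [p pK] := injective_retraction (s := sub_val _) Binj val_inj.
have AB := retraction_direct_sum pK.
exists (sub_ker p), (sub_ips_trace E); split=> //.
apply/seteqP; split=> // x _ N Nmax.
have [t tT /negP[]] := max_QF_trace_maximal hered mQF (injective_summand AB Einj) Nmax.
have -> : t = 0; last exact: rpred0.
have /internal_direct_sumP[_ cap] := AB.
apply: val_inj; apply: cap (mem_sub_val t) _; apply/submod_ofP.
exact: (ips_trace_map (sub_val _)) tT.
Qed.

End RadicalDecomposition.

(** * Embedding a ring in an injective module *)

Local Notation "M ^z" := (zmodule M) (at level 2, format "M ^z") : type_scope.

Section RationalsModuloIntegers.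

Fact int_rat_is_submod : is_submod [set q : rat^z | exists n : int, q = n%:~R].
Proof.
split=> [|_ _ [m ->] [n ->]|k _ [n ->]]; first by exists 0.
- by exists (m + n); rewrite rmorphD.
- by exists (n * k); rewrite scalezrE -mulrzA.
Qed.

Definition rat_mod_int : lmodType int := quotmod (submod_of int_rat_is_submod).
Definition rat_class : {linear rat^z -> rat_mod_int} := quot_proj _.

Lemma rat_class_eq0 (q : rat) :
  rat_class q = 0 <-> exists n : int, q = n%:~R.
Proof.
split=> [/eqP|qn]; first by rewrite quot_proj_eq0 => /submod_ofP.
by apply/eqP; rewrite quot_proj_eq0; apply/submod_ofP.
Qed.

Lemma int_ideal_principal (I : submodClosed int^o) :
  exists n : int^o, n \in I /\ forall m : int^o, m \in I -> exists k : int, m = k * n.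
Proof.
have [I0|/existsNP[m0 /not_implyP[m0I /eqP m00]]] :=
    pselect (forall m : int, m \in I -> m = 0).
  by exists 0; split=> [|m /I0 ->]; [exact: rpred0|exists 0].
have exn : exists n : nat, (0 < n)%N && ((n : int) \in I).
  exists `|m0|%N; rewrite absz_gt0 m00 /=.
  by rewrite abszEsg -[_ * _]/(sgz m0 *: (m0 : int^o)); apply: (@submodZ _ int^o).
exists (ex_minn exn); case: ex_minnP => n /andP[n0 nI] nmin; split=> // m mI.
exists (m %/ n)%Z; have mE := divz_eq m n.
suff r0 : (m %% n)%Z = 0 by rewrite [LHS]mE r0 addr0.
have rI : (m %% n)%Z \in I.
  have -> : (m %% n)%Z = m - (m %/ n)%Z *: (n : int^o) by rewrite {2}mE addrC addKr.
  by apply: (@submodB _ int^o) => //; apply: (@submodZ _ int^o).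
have r_ge0 : 0 <= (m %% n)%Z by rewrite modz_ge0 // eqz_nat -lt0n.
have r_lt : ((m %% n)%Z < n)%R by apply: ltz_pmod.
case: (m %% n)%Z rI r_ge0 r_lt => // r rI _ rn.
case: r rI rn => // r rI; rewrite ltz_nat => rn.
by have := nmin r.+1 rI; rewrite leqNgt rn.
Qed.

(** Ideals of the integers are principal and Q/Z is divisible. *)
Lemma rat_mod_int_injective : injective_module rat_mod_int.
Proof.
apply: baer_injective => I f.
have [n [nI In]] := int_ideal_principal I.
have [n0|n0] := eqVneq n 0.
  exists 0 => i; have [k iE] := In _ (mem_sub_val i).
  have -> : i = 0 by apply: val_inj; rewrite iE n0 mulr0.
  by rewrite !raddf0.
have [q qE] := quot_proj_surj (f (Sub n nI)).
exists (rat_class (q / n%:~R)) => i; have [k iE] := In _ (mem_sub_val i).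
have -> : i = k *: (Sub n nI : submod I) by apply: val_inj; rewrite iE.
rewrite linearZ /= -qE -linearZ -[RHS]linearZ; congr (rat_class _).
rewrite !scalezrE -mulrzl -[RHS]mulrzl rmorphM /= -mulrA; congr (_ * _).
by rewrite mulrCA divff ?mulr1 // intr_eq0.
Qed.

(** Send a to the class of 1/n, where n generates the annihilator of a if that
    is nonzero, and n = 2 otherwise; then extend to V by injectivity. *)
Lemma rat_mod_int_separates (V : zmodType) (a : V) : a != 0 ->
  exists h : {linear V^z -> rat_mod_int}, h a != 0.
Proof.
move=> a0.
have hI : is_submod [set k : int^o | a *~ k = 0].
  split=> [|k l /= ka la|k l /= la]; first by rewrite /= mulr0z.
  - by rewrite mulrzDr ka la addr0.
  - by rewrite -[k *: l]/(k * l) mulrC mulrzA la mul0rz.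
have [n [n2 nP]] : exists n : int, (1 < `|n|)%N /\
    forall k : int, a *~ k = 0 -> exists m : int, k = m * n.
  have [n [/submod_ofP /= na In]] := int_ideal_principal (submod_of hI).
  have {}In k : a *~ k = 0 -> exists m, k = m * n by move=> ka; apply/In/submod_ofP.
  have [n0|n0] := eqVneq n 0.
    by exists 2; split=> // k /In[m ->]; exists 0; rewrite n0 mulr0 mul0r.
  exists n; split=> //; rewrite ltnNge leq_eqVlt ltnS leqn0 absz_eq0 (negbTE n0) orbF.
  apply/negP => n1; case/negP: a0; apply/eqP.
  rewrite -[a]mulr1z -[1 in LHS]/(1%N%:Z) -(eqP n1) abszEsg mulrC mulrzA na.
  exact: mul0rz.
have n0 : n != 0 by rewrite -absz_gt0 ltnW.
pose y := rat_class (n%:~R)^-1.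
have hG : is_submod [set z : (V^z * rat_mod_int)%type | exists k : int, z = (a *~ k, k *: y)].
  split=> [|_ _ [k ->] [l ->]|c _ [k ->]].
  - by exists 0; rewrite mulr0z scale0r.
  - by exists (k + l); rewrite mulrzDr scalerDl.
  - by exists (c * k); rewrite -scalerA mulrC mulrzA.
have [||h hE] := @baer_extension int V^z rat_mod_int (submod_of hG).
- exact/injective_baer/rat_mod_int_injective.
- move=> z /submod_ofP[k [/esym/nP[m ->] ->]].
  rewrite /y -linearZ; apply/rat_class_eq0; exists m.
  by rewrite scalezrE -mulrzl rmorphM /= mulfK // intr_eq0.
exists h; rewrite (hE a y); last by apply/submod_ofP; exists 1; rewrite mulr1z scale1r.
apply/eqP => /rat_class_eq0[m mE].
have : n%:~R * m%:~R = 1 :> rat by rewrite -mE divff // intr_eq0.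
rewrite -rmorphM -[RHS]mulr1z => /eqP; rewrite eqr_int => /eqP /(congr1 absz).
by rewrite abszM => /eqP; rewrite muln_eq1 => /andP[/eqP n1]; rewrite n1 in n2.
Qed.

End RationalsModuloIntegers.

Section Coinduced.
Variables (K : pzRingType) (X : Type).

Definition additive_family : {pred X -> K -> rat_mod_int} :=
  fun phi => `[< forall c x y, phi c (x + y) = phi c x + phi c y >].

Fact additive_family_closed : zmod_closed additive_family.
Proof.
split=> [|phi psi /asboolP phiD /asboolP psiD]; apply/asboolP => c x y /=.
  by rewrite addr0.
rewrite -[LHS]/(phi c (x + y) - psi c (x + y)) phiD psiD opprD addrACA.
by [].
Qed.

HB.instance Definition _ :=
  GRing.isZmodClosed.Build (X -> K -> rat_mod_int) additive_family
    additive_family_closed.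

(** A power of the character module Hom(K, Q/Z), with K acting through right
    multiplication on the argument. *)
Definition coinduced : Type :=
  {phi : X -> K -> rat_mod_int | phi \in additive_family}.

HB.instance Definition _ := SubChoice.on coinduced.
HB.instance Definition _ := [SubChoice_isSubZmodule of coinduced by <:].

Definition mk_coinduced phi (h : phi \in additive_family) : coinduced :=
  exist _ phi h.

Lemma coinducedD (phi : coinduced) c x y :
  val phi c (x + y) = val phi c x + val phi c y.
Proof. by have /asboolP := valP phi; apply. Qed.

Fact coinduced_scale_subproof (a : K) (phi : coinduced) :
  (fun c x => val phi c (x * a)) \in additive_family.
Proof. by apply/asboolP => c x y; rewrite mulrDl coinducedD. Qed.

Definition coinduced_scale (a : K) (phi : coinduced) : coinduced :=
  mk_coinduced (coinduced_scale_subproof a phi).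

Lemma coinduced_eq (phi psi : coinduced) :
  (forall c x, val phi c x = val psi c x) -> phi = psi.
Proof. by move=> E; apply/val_inj/funext => c; apply/funext => x. Qed.

Fact coinduced_scaleA a b phi :
  coinduced_scale a (coinduced_scale b phi) = coinduced_scale (a * b) phi.
Proof. by apply: coinduced_eq => c x /=; rewrite mulrA. Qed.

Fact coinduced_scale1 : left_id 1 coinduced_scale.
Proof. by move=> phi; apply: coinduced_eq => c x /=; rewrite mulr1. Qed.

Fact coinduced_scaleDr : right_distributive coinduced_scale +%R.
Proof. by move=> a phi psi; apply: coinduced_eq. Qed.

Fact coinduced_scaleDl phi : {morph coinduced_scale^~ phi : a b / a + b}.
Proof.
by move=> a b; apply: coinduced_eq => c x; rewrite [LHS]/= mulrDr coinducedD.
Qed.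

HB.instance Definition _ := GRing.Zmodule_isLmodule.Build K coinduced
  coinduced_scaleA coinduced_scale1 coinduced_scaleDr coinduced_scaleDl.

(** A K-linear map to Hom(K, Q/Z) amounts to its value at 1, an additive map to
    Q/Z; so the injectivity of Q/Z over the integers is enough. *)
Lemma coinduced_injective : injective_module coinduced.
Proof.
move=> M N f g finj.
have fz : linear (f : M^z -> N^z).
  by move=> k x y; rewrite !scalezrE raddfD raddfMz.
have [fz' fz'E] := linear_exists fz.
have step c : exists h : {linear N^z -> rat_mod_int}, forall m, h (f m) = val (g m) c 1.
  have gz : linear ((fun m => val (g m) c 1) : M^z -> rat_mod_int).
    move=> k x y; rewrite raddfD -[LHS]/(val (g (x *~ k)) c 1 + val (g y) c 1).
    congr (_ + _); rewrite -[k in RHS]intz scaler_int.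
    have gB : zmod_morphism (fun m => val (g m) c 1 : rat_mod_int).
      by move=> m n; rewrite raddfB.
    pose gA := HB.pack_for {additive M -> rat_mod_int} (fun m => val (g m) c 1)
      (GRing.isZmodMorphism.Build M rat_mod_int _ gB).
    exact: (raddfMz gA).
  have [gz' gz'E] := linear_exists gz.
  have [|h hE] := @rat_mod_int_injective _ _ fz' gz'.
    by move=> x y; rewrite !fz'E => /finj.
  by exists h => m; rewrite -fz'E -[LHS]/((h \o fz') m) -hE gz'E.
have [h hE] := choice step.
have hadd (n : N) : (fun c (x : K) => h c (x *: n)) \in additive_family.
  by apply/asboolP => c x y; rewrite scalerDl raddfD.
have [|h' h'E] := @linear_exists K N coinduced (fun n => mk_coinduced (hadd n)).
  move=> a x y; apply: coinduced_eq => c b /=.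
  by rewrite scalerDr scalerA raddfD.
exists h' => m; apply: coinduced_eq => c x; rewrite /= h'E /= -linearZ hE linearZ /=.
by rewrite mul1r.
Qed.

End Coinduced.

(** Evaluate all characters of K: an element a goes to the family of the maps
    [x |-> c (x a)], and c can be chosen nonzero at a given nonzero a. *)
Lemma regular_embeds_injective (K : pzRingType) :
  exists (E : lmodType K) (j : {linear K^o -> E}), injective_module E /\ injective j.
Proof.
pose X := {linear K^z -> rat_mod_int}.
exists (coinduced K X).
have jadd (a : K) : (fun (c : X) x => c (x * a)) \in @additive_family K X.
  by apply/asboolP => c x y; rewrite mulrDl raddfD.
have [|j jE] := @linear_exists K K^o (coinduced K X) (fun a => mk_coinduced (jadd a)).
  by move=> a x y; apply: coinduced_eq => c b /=; rewrite mulrDr raddfD mulrA.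
exists j; split=> [|a b]; first exact: coinduced_injective.
rewrite !jE => jab; apply/eqP; rewrite -subr_eq0; apply: contrapT => /negP ab.
have [c /negP[]] := rat_mod_int_separates ab; rewrite raddfB subr_eq0; apply/eqP.
have /(congr1 (fun phi => val phi c 1)) := jab.
by rewrite /= !mul1r.
Qed.

(** * Semisimple rings *)

Section SemisimpleRings.
Variable K : pzRingType.

(** The union U of a chain has a complement, and the U-component u of 1 lies in
    some member of the chain; every x in U is x u. *)
Lemma semisimple_noetherian : semisimple_module K^o -> noetherian K.
Proof.
move=> Kss I Iinc.
have Imono m n x : (m <= n)%N -> x \in I m -> x \in I n.
  move=> /subnK <-; elim: (n - m)%N => // k IH xm.
  by rewrite addSn; apply: Iinc; apply: IH.
have hU : is_submod [set x : K^o | exists n, x \in I n].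
  split=> [|x y [m xm] [n yn]|a x [n xn]]; first by exists 0%N; apply: rpred0.
    exists (maxn m n); apply: rpredD.
      by apply: Imono xm; apply: leq_maxl.
    by apply: Imono yn; apply: leq_maxr.
  by exists n; apply: rpredZ.
have [D /internal_direct_sumP[UD cap]] := Kss (submod_of hU).
have [u [d [/submod_ofP[n un] dD oneE]]] := UD 1.
have xE x m : x \in I m -> x \in I n.
  move=> xm; have x1 : (x : K) *: (1 : K^o) = x by apply: mulr1.
  have xd0 : (x : K) *: d = 0.
    apply: cap; last exact: rpredZ.
    have -> : (x : K) *: d = x - (x : K) *: u.
      by rewrite -{2}x1 oneE scalerDr addrC addKr.
    by apply: submodB; apply/submod_ofP; [exists m|exists n; apply: rpredZ].
  by rewrite -x1 oneE scalerDr xd0 addr0; apply: rpredZ.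
by exists n => m nm; apply/eq_submodP => x; apply/idP/idP => [/xE//|]; apply: Imono.
Qed.

(** Since the ring is Noetherian, there is a maximal C among the complements of
    the members of the chain.  If C is a complement of [I n], the later members
    equal [I n], for otherwise a complement of [I m] in [I n] could be added
    to C. *)
Lemma semisimple_dcc (I : nat -> submodClosed K^o) : semisimple_module K^o ->
  (forall n, [set` I n.+1] `<=` [set` I n]) ->
  exists n, forall m, (n <= m)%N -> [set` I m] = [set` I n].
Proof.
move=> Kss Idec.
have Imono m n x : (m <= n)%N -> x \in I n -> x \in I m.
  move=> /subnK <-; elim: (n - m)%N => // k IH xm.
  by apply: IH; apply: Idec; rewrite -addSn.
pose compl n C := internal_direct_sum (I n) C.
have [|C [[n nC] Cmax]] :=
    @noetherian_maximal K [set C | exists n, compl n C] (semisimple_noetherian Kss).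
  by have [C C0] := Kss (I 0%N); exists C, 0%N.
exists n => m nm; apply/eq_submodP => x; apply/idP/idP; first exact: Imono.
move=> xn; have [AB cap] := (internal_direct_sumP _ _).1 nC.
have [D /internal_direct_sumP[mD capD]] := Kss (I m).
pose C' := sub_sum C (sub_cap D (I n)).
have C'm : compl m C'.
  apply/internal_direct_sumP; split=> [y|y ym /sub_sumP[c [d [cC]]]].
    have [a [c [an cC ->]]] := AB y; have [b [d [bm dD aE]]] := mD a.
    exists b, (c + d); rewrite aE -addrA [d + c]addrC; split=> //.
    apply/sub_sumP; exists c, d; split=> //; apply/submod_ofP; split=> //.
    have -> : d = a - b by rewrite aE addrC addKr.
    by rewrite submodB //; apply: Imono bm.
  move=> /submod_ofP[dD dn] yE; have c0 : c = 0.
    apply: cap => //; have -> : c = y - d by rewrite yE addrK.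
    by rewrite submodB //; apply: Imono ym.
  by apply: capD => //; rewrite yE c0 add0r.
have [a [d [am dD xE]]] := mD x.
have dn : d \in I n.
  have -> : d = x - a by rewrite xE addrC addKr.
  by rewrite submodB //; apply: Imono am.
suff d0 : d = 0 by rewrite xE d0 addr0.
apply: cap => //; apply: (Cmax C'); first by exists m.
  by move=> c; apply: sub_suml.
by apply: sub_sumr; apply/submod_ofP.
Qed.

End SemisimpleRings.

(** * Change of rings *)

Section Restriction.
Variables (K K' : pzRingType) (p : {rmorphism K -> K'}).

(** The ring morphism is a parameter of the carrier type so that the scaling
    can be found from the type alone. *)
Definition restr of {rmorphism K -> K'} := fun M : lmodType K' => M : Type.

Variable M : lmodType K'.
Local Notation rM := (restr p M).

HB.instance Definition _ := GRing.Zmodule.on rM.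

Definition restr_scale (a : K) (x : rM) : rM := p a *: (x : M).

Fact restr_scaleA a b x : restr_scale a (restr_scale b x) = restr_scale (a * b) x.
Proof. by rewrite /restr_scale scalerA rmorphM. Qed.

Fact restr_scale1 : left_id 1 restr_scale.
Proof. by move=> x; rewrite /restr_scale rmorph1 scale1r. Qed.

Fact restr_scaleDr : right_distributive restr_scale +%R.
Proof. by move=> a x y; rewrite /restr_scale scalerDr. Qed.

Fact restr_scaleDl x : {morph restr_scale^~ x : a b / a + b}.
Proof. by move=> a b; rewrite /restr_scale rmorphD scalerDl. Qed.

HB.instance Definition _ := GRing.Zmodule_isLmodule.Build K rM
  restr_scaleA restr_scale1 restr_scaleDr restr_scaleDl.

Lemma restrZ (a : K) (x : M) : a *: (x : rM) = p a *: x.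
Proof. by []. Qed.

Lemma restr_submod (A : submodClosed M) : is_submod ([set x | x \in A] : set rM).
Proof.
split=> /= [|x y|a x]; first exact: (rpred0 A).
- exact: (@rpredD _ A).
- exact: (@submodZ _ M).
Qed.

Lemma corestr_submod (A : submodClosed rM) : surjective p ->
  is_submod ([set x | x \in A] : set M).
Proof.
move=> ps; split=> /= [|x y|a x]; first exact: (rpred0 A).
- exact: (@rpredD _ A).
- by have [b <-] := ps a; apply: (@submodZ _ rM).
Qed.

Lemma semisimple_corestr : surjective p ->
  semisimple_module rM -> semisimple_module M.
Proof.
move=> ps Mss A.
have [B /internal_direct_sumP[AB cap]] := Mss (submod_of (restr_submod A)).
exists (submod_of (corestr_submod B ps)); apply/internal_direct_sumP; split=> x.
  have [a [b [/submod_ofP aA bB ->]]] := AB x; exists a, b.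
  by split=> //; apply/submod_ofP.
by move=> xA /submod_ofP; apply: cap; apply/submod_ofP.
Qed.

End Restriction.

Lemma restr_linear (K K' : pzRingType) (p : {rmorphism K -> K'}) (M N : lmodType K')
    (f : {linear M -> N}) :
  exists g : {linear restr p M -> restr p N}, forall x, g x = f x.
Proof.
have [|g gE] := @linear_exists K (restr p M) (restr p N) f; last by exists g.
by move=> a x y; rewrite restrZ [LHS]linearP.
Qed.

Section Converse.
Variables (R S : pzRingType) (f : {rmorphism R -> S}).

Definition converse_map : R^c -> S^c := f.

Fact converse_map_is_zmod_morphism : zmod_morphism converse_map.
Proof. exact: (raddfB f). Qed.

Fact converse_map_is_monoid_morphism : monoid_morphism converse_map.
Proof. by split=> [|x y]; [apply: (rmorph1 f)|apply: (rmorphM f)]. Qed.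

HB.instance Definition _ := GRing.isZmodMorphism.Build R^c S^c converse_map
  converse_map_is_zmod_morphism.
HB.instance Definition _ := GRing.isMonoidMorphism.Build R^c S^c converse_map
  converse_map_is_monoid_morphism.

Definition converse_rmorphism : {rmorphism R^c -> S^c} := converse_map.

End Converse.

(** * Corner rings at a central idempotent *)

Record central_idempotent (R : pzRingType) (e : R) : Prop := CentralIdempotent {
  idempotent_mul : e * e = e;
  central_comm : forall x, x * e = e * x }.

Section Corner.
Variables (R : pzRingType) (e : R) (eP : central_idempotent e).

Definition corner_pred of central_idempotent e : {pred R} := fun x => x * e == x.

Fact corner_pred_closed : zmod_closed (corner_pred eP).
Proof.
split=> [|x y /eqP xe /eqP ye]; apply/eqP; first by rewrite mul0r.
by rewrite mulrBl xe ye.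
Qed.

HB.instance Definition _ := GRing.isZmodClosed.Build R (corner_pred eP) corner_pred_closed.

(** The ring eR with unit e; as e is central, it is both a factor and a quotient
    of R. *)
Definition corner : Type := {x : R | x \in corner_pred eP}.

HB.instance Definition _ := SubChoice.on corner.
HB.instance Definition _ := [SubChoice_isSubZmodule of corner by <:].

Lemma corner_val (x : corner) : val x * e = val x.
Proof. by apply/eqP; apply: (valP x). Qed.

Definition mk_corner x (h : x * e = x) : corner :=
  exist _ x (introT eqP h).

Fact corner_mul_subproof (x y : corner) : (val x * val y) * e = val x * val y.
Proof. by rewrite -mulrA corner_val. Qed.

Definition corner_mul (x y : corner) : corner := mk_corner (corner_mul_subproof x y).
Definition corner_one : corner := mk_corner (idempotent_mul eP).

Fact corner_mulA : associative corner_mul.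
Proof. by move=> x y z; apply: val_inj; rewrite /= mulrA. Qed.
Fact corner_mul1x : left_id corner_one corner_mul.
Proof. by move=> x; apply: val_inj; rewrite /= -(central_comm eP) corner_val. Qed.
Fact corner_mulx1 : right_id corner_one corner_mul.
Proof. by move=> x; apply: val_inj; rewrite /= corner_val. Qed.
Fact corner_mulDl : left_distributive corner_mul +%R.
Proof. by move=> x y z; apply: val_inj; rewrite /= mulrDl. Qed.
Fact corner_mulDr : right_distributive corner_mul +%R.
Proof. by move=> x y z; apply: val_inj; rewrite /= mulrDr. Qed.

HB.instance Definition _ := GRing.Zmodule_isPzRing.Build corner
  corner_mulA corner_mul1x corner_mulx1 corner_mulDl corner_mulDr.

Lemma corner_valM (x y : corner) : val (x * y) = val x * val y.
Proof. by []. Qed.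

Fact to_corner_subproof x : (x * e) * e = x * e.
Proof. by rewrite -mulrA (idempotent_mul eP). Qed.

Definition to_corner (x : R) : corner := mk_corner (to_corner_subproof x).

Fact to_corner_is_zmod_morphism : zmod_morphism to_corner.
Proof. by move=> x y; apply: val_inj; rewrite /= mulrBl. Qed.

Fact to_corner_is_monoid_morphism : monoid_morphism to_corner.
Proof.
split=> [|x y]; apply: val_inj; rewrite /= ?mul1r //.
by rewrite [RHS]mulrA -[x * e * y]mulrA -(central_comm eP y) -!mulrA (idempotent_mul eP).
Qed.

HB.instance Definition _ := GRing.isZmodMorphism.Build R corner to_corner
  to_corner_is_zmod_morphism.
HB.instance Definition _ := GRing.isMonoidMorphism.Build R corner to_corner
  to_corner_is_monoid_morphism.

Lemma to_cornerK : cancel val to_corner.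
Proof. by move=> x; apply: val_inj; rewrite /= corner_val. Qed.

Lemma corner_mul_to (x : corner) (a : R) : val (x * to_corner a) = val x * a.
Proof. by rewrite corner_valM /= (central_comm eP) mulrA corner_val. Qed.

Definition corner_proj : {rmorphism R^c -> corner^c} := converse_rmorphism to_corner.

Lemma corner_proj_surj : surjective corner_proj.
Proof. by move=> x; exists (val x); apply: to_cornerK. Qed.

Lemma corner_proj_val (x : corner) : corner_proj (val x) = x.
Proof. exact: to_cornerK. Qed.

Lemma corner_val_linear :
  exists u : {linear restr corner_proj (corner^c)^o -> R^c^o},
    forall t, u t = val (t : corner).
Proof.
have [|u uE] := @linear_exists R^c (restr corner_proj (corner^c)^o) R^c^o
    (fun t => val (t : corner)); last by exists u.
move=> a x y.
(* The sum and the scaling are those of the ring [corner], seen through the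
   converse, regular and restricted module structures. *)
have sumE : val ((x : corner) * to_corner a + (y : corner)) =
            val ((x : corner) * to_corner a) + val (y : corner).
  by rewrite raddfD.
have scaleE : val ((x : corner) * to_corner a) = a *: (val (x : corner) : R^c^o).
  exact: corner_mul_to.
rewrite -[RHS]/((a *: (val (x : corner) : R^c^o) : R^c^o) + val (y : corner)).
by rewrite -scaleE -sumE.
Qed.

(** ** Modules over the corner *)

Variables (Q : lmodType R^c) (eQ : forall q : Q, (e : R^c) *: q = q).

(** A module on which e acts as the identity is a module over the corner; the
    proof of this is kept in the carrier type, for the scaling to depend on. *)
Definition corner_mod of (forall q : Q, (e : R^c) *: q = q) : Type := Q.
Local Notation cQ := (corner_mod eQ).

HB.instance Definition _ := GRing.Zmodule.on cQ.

Definition corner_scale (a : corner^c) (q : cQ) : cQ := (val a : R^c) *: (q : Q).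

Fact corner_scaleA a b q : corner_scale a (corner_scale b q) = corner_scale (a * b) q.
Proof. by rewrite /corner_scale scalerA. Qed.
Fact corner_scale1 : left_id 1 corner_scale.
Proof. exact: eQ. Qed.
Fact corner_scaleDr : right_distributive corner_scale +%R.
Proof. by move=> a x y; rewrite /corner_scale scalerDr. Qed.
Fact corner_scaleDl x : {morph corner_scale^~ x : a b / a + b}.
Proof. by move=> a b; rewrite /corner_scale -scalerDl. Qed.

HB.instance Definition _ := GRing.Zmodule_isLmodule.Build corner^c cQ
  corner_scaleA corner_scale1 corner_scaleDr corner_scaleDl.

Lemma corner_modZ (a : R^c) (q : Q) : corner_proj a *: (q : cQ) = a *: q.
Proof.
by rewrite -[LHS]/(((e : R^c) * a) *: q) -scalerA eQ.
Qed.

Lemma corner_mod_submod (L : submodClosed cQ) : is_submod ([set x | x \in L] : set Q).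
Proof.
split=> /= [|x y|a x xL]; first exact: (rpred0 L).
  exact: (@rpredD _ L).
by rewrite -corner_modZ; apply: (@submodZ _ cQ).
Qed.

(** Maps over the corner between such modules are the same as maps over R, after
    restriction along the projection of R on the corner. *)
Lemma corner_mod_injective : injective_module Q -> injective_module cQ.
Proof.
move=> Qinj M N f g finj.
have [f' f'E] := restr_linear corner_proj f.
have [|g' g'E] := @linear_exists R^c (restr corner_proj M) Q g.
  by move=> a x y; rewrite -corner_modZ restrZ [LHS]linearP.
have [|h hE] := Qinj _ _ f' g'; first by move=> x y; rewrite !f'E => /finj.
have [|h' h'E] := @linear_exists corner^c N cQ h.
  move=> a x y; rewrite -[a](corner_proj_val a).
  by rewrite corner_modZ -[in LHS]restrZ [LHS]linearP.
by exists h' => x; rewrite /= h'E -f'E -[RHS]/((h \o f') x) -hE g'E.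
Qed.

End Corner.

(** * From injective modules to a decomposition of the ring *)

Section RingDecomposition.
Variable R : pzRingType.
Local Notation K := (R^c).

Definition radical_decomposition : Prop :=
  forall E : lmodType K, injective_module E ->
    exists A B : submodClosed E,
      [/\ internal_direct_sum A B, Rad (submod A) = setT,
          projective_module (submod B) & semisimple_module (submod B)].

Lemma left_mul_linear (r : R) :
  exists u : {linear K^o -> K^o}, forall x : R, u x = r * x.
Proof.
have [|u uE] := @linear_exists K K^o K^o (fun x : R => r * x : K^o); last by exists u.
by move=> a x y; rewrite [LHS]mulrDr; congr (_ + _); exact: (@mulrA R r x a).
Qed.

(** The trace is an injective right ideal, so a retraction of R on it is left
    multiplication by an idempotent e.  Left multiplications are endomorphisms
    of the right module R, so they preserve the trace, which gives ere = re.
    For ere = er, let y = er(1-e): it is in the trace, so y = yc for some c in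
    the trace by [ips_trace_reflect] applied to the left multiplication by y;
    then c = ec, and ye = 0. *)
Lemma ips_trace_central : noetherian K ->
  exists e : R, central_idempotent e /\
    forall x : R, @ips_trace K K^o x <-> e * x = x.
Proof.
move=> noeth.
have [p pK] := injective_retraction (s := sub_val (sub_ips_trace K^o))
  (ips_trace_injective noeth) val_inj.
pose e : R := val (p 1).
have eB : @ips_trace K K^o e by have /submod_ofP := mem_sub_val (p 1).
have eM (x : R) : e * x = val (p x).
  have xE : (x : K^o) = (x : K) *: (1 : K^o) by apply/esym/(mulr1 (x : K)).
  by rewrite {2}xE [p _]linearZ.
have traceE (x : R) : @ips_trace K K^o x <-> e * x = x.
  split=> [xB|<-]; last by rewrite eM; have /submod_ofP := mem_sub_val (p x).
  have xB' : (x : K^o) \in sub_ips_trace K^o by apply/submod_ofP.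
  by rewrite eM -[x in p x]/(val (Sub x xB' : submod (sub_ips_trace K^o))) pK.
have ee : e * e = e by apply/traceE.
have re (r : R) : e * (r * e) = r * e.
  by apply/traceE; have [u <-] := left_mul_linear r; apply: ips_trace_map.
have er (r : R) : e * r = e * (r * e).
  pose y := e * (r * (1 - e)).
  have yB : @ips_trace K K^o y by apply/traceE; rewrite mulrA ee.
  have [u uE] := left_mul_linear y.
  have [|c /traceE cB uc] := @ips_trace_reflect K K^o K^o u 1.
    by rewrite uE mulr1.
  have y0 : y = 0.
    move: uc; rewrite !uE mulr1 => <-; rewrite -cB mulrA /y -!mulrA.
    by rewrite [(1 - e) * _]mulrA mulrBl mul1r ee subrr mul0r !mulr0.
  by apply/eqP; rewrite -subr_eq0 -mulrBr -{1}[r]mulr1 -mulrBr -/y y0.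
by exists e; split=> //; split=> // x; rewrite -re -er.
Qed.

Lemma ips_corner_semisimple (e : R) (eP : central_idempotent e) :
  noetherian K -> (forall x : R, e * x = x -> @ips_trace K K^o x) ->
  semisimple_artinian (corner eP).
Proof.
move=> noeth eB; suff Sss : semisimple_module ((corner eP)^c)^o.
  by split=> // I; apply: semisimple_dcc.
apply: (semisimple_corestr (p := corner_proj eP)); first exact: corner_proj_surj.
have [_ _ Bss] := @ips_trace_ips K K^o noeth.
have [|u uE] := @linear_exists K K^o (restr (corner_proj eP) ((corner eP)^c)^o)
    (to_corner eP).
  move=> a x y; rewrite restrZ raddfD; congr (_ + _).
  exact: (rmorphM (to_corner eP) x a).
apply: (semisimple_quotient (u := u \o sub_val _) Bss) => t.
have tB : (val t : K^o) \in sub_ips_trace K^o.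
  by apply/submod_ofP/eB; rewrite -(central_comm eP) corner_val.
by exists (Sub (val t : K^o) tB); rewrite /= uE to_cornerK.
Qed.

(** The corner T lies in an injective R-module E.  For C maximal among the
    submodules meeting T in 0, the module E/C is an essential extension of T,
    and as a quotient of E it is injective over a hereditary ring. *)
Lemma corner_hull (e : R) (eP : central_idempotent e) : hereditary K ->
  exists (Q : lmodType K) (i : {linear restr (corner_proj eP) ((corner eP)^c)^o -> Q}),
    [/\ injective_module Q, injective i &
        forall L : submodClosed Q, (forall t, i t \in L -> t = 0) ->
          forall q, q \in L -> q = 0].
Proof.
move=> hered; have [E [j [Einj jinj]]] := regular_embeds_injective K.
pose T := restr (corner_proj eP) ((corner eP)^c)^o.
have [v vE] := corner_val_linear eP.
pose k : {linear T -> E} := j \o v.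
have kE t : k t = j (val (t : corner eP)) by rewrite /= vE.
have kinj : injective k by move=> s t; rewrite !kE => /jinj/val_inj.
have [C [kC Cmax]] := disjoint_complement (sub_range k).
exists (quotmod C), (quot_proj C \o k); split.
- exact: (hereditary_quotient (u := quot_proj C)) (@quot_proj_surj _ _ _).
- move=> s t /= st; apply: kinj; apply/eqP; rewrite -subr_eq0; apply/eqP.
  apply: kC; first by rewrite -linearB; apply/submod_ofP; exists (s - t).
  by rewrite -quot_proj_eq0 linearB /= st subrr.
- move=> L Li q; have [x <-] := quot_proj_surj q => xL.
  apply/eqP; rewrite quot_proj_eq0; apply: (Cmax (sub_preim (quot_proj C) L)).
  + move=> y; rewrite -quot_proj_eq0 => /eqP y0; apply/submod_ofP.
    by rewrite /= y0 rpred0.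
  + by move=> _ /submod_ofP[t _ <-] /submod_ofP /Li ->; rewrite raddf0.
  + exact/submod_ofP.
Qed.


(** The complementary idempotent acts as 0 on the hull Q, since it does so on T
    and T is essential; thus Q is a hull over the corner.  The projective part B
    of Q given by the decomposition meets T in elements of the trace of R, by
    [ips_trace_reflect] along the embedding of T.  So B = 0 and Q has no maximal
    submodule, whereas T + L = Q with L proper would produce one. *)
Lemma corner_small (e : R) (eP : central_idempotent e) :
  hereditary K -> radical_decomposition ->
  (forall t : R, t * e = t -> @ips_trace K K^o t -> t = 0) ->
  right_small (corner eP).
Proof.
move=> hered decomp T0.
have [Q [i [Qinj iinj Qess]]] := corner_hull eP hered.
pose oneT : restr (corner_proj eP) ((corner eP)^c)^o := (1 : corner eP).
have iE (a : K) : i (corner_proj eP a : corner eP) = a *: i oneT.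
  by rewrite -linearZ restrZ; congr (i _); exact: (esym (mulr1 (corner_proj eP a))).
have eQ (q : Q) : (e : K) *: q = q.
  (* L = (1 - e) Q meets T in 0. *)
  have hL : is_submod [set x : Q | exists y, x = y - (e : K) *: y].
    split=> [|_ _ [x ->] [y ->]|a _ [y ->]]; first by exists 0; rewrite scaler0 subr0.
    - by exists (x + y); rewrite scalerDr opprD addrACA.
    - exists (a *: y); rewrite scalerBr !scalerA; congr (_ - _ *: _).
      exact: (esym (central_comm eP a)).
  apply/eqP; rewrite eq_sym -subr_eq0; apply/eqP/(Qess (submod_of hL)); last first.
    by apply/submod_ofP; exists q.
  move=> t /submod_ofP[y ty].
  have : i ((e : K) *: t) = i t.
    congr (i _); rewrite restrZ; apply: val_inj.
    rewrite -[LHS]/(val (t : corner eP) * (e * e)) (idempotent_mul eP).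
    exact: corner_val.
  rewrite linearZ ty /= scalerBr scalerA [(e : K) * _](idempotent_mul eP) subrr => t0.
  by apply: iinj; rewrite ty -t0 raddf0.
have [|j jE] := @linear_exists (corner eP)^c ((corner eP)^c)^o (corner_mod eQ) i.
  move=> a x y; rewrite -{1}[a](corner_proj_val a).
  have := linearP i (val a : K) x y.
  by rewrite restrZ corner_proj_val => ->.
exists (corner_mod eQ), j; split; first split.
- exact: corner_mod_injective.
- by move=> x y; rewrite !jE => /iinj.
- move=> L Lne cap0; apply: Lne; apply/seteqP; split=> [q /= qL|_ ->]; last exact: rpred0.
  have hL := corner_mod_submod L.
  apply: (Qess (submod_of hL)); last exact/submod_ofP.
  move=> t /submod_ofP tL; apply: iinj; rewrite raddf0.
  by have : (range j `&` [set` L]) (i t); [split=> //; exists t => //; rewrite jE|rewrite cap0].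
- move=> L Lproper jL.
  have hL := corner_mod_submod L.
  pose L' := submod_of hL.
  have iL (q : Q) : exists (a : K) l, l \in L' /\ q = a *: i oneT + l.
    have [_ [t _ <-] [l lL <-]] : submodule_sum (range j) [set` L] q by rewrite jL.
    exists (val (t : corner eP)), l; split; first exact/submod_ofP.
    by rewrite jE -iE corner_proj_val.
  have i1L : i oneT \notin L'.
    apply/negP => i1L; have /proper_submoduleP[q /negP[]] := Lproper.
    have [a [l [lL ->]]] := iL q.
    by apply/(submod_ofP hL); rewrite rpredD ?rpredZ.
  have [A [B [AB RadA Bproj Bss]]] := decomp Q Qinj.
  have [AB1 AB2] := (internal_direct_sumP _ _).1 AB.
  have BA : internal_direct_sum B A.
    apply/internal_direct_sumP; split=> [q|q qB qA]; last exact: AB2.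
    by have [a [b [aA bB ->]]] := AB1 q; exists b, a; rewrite addrC.
  have Bips : ips_module (submod B) by split=> //; exact: injective_summand BA Qinj.
  have B0 : forall b, b \in B -> b = 0.
    apply: Qess => t tB.
    have [c cips /iinj ct] := ips_trace_reflect (ips_trace_sub Bips tB).
    have [v vE] := corner_val_linear eP.
    apply: val_inj; apply: T0; first exact: corner_val.
    by have := ips_trace_map v cips; rewrite ct vE.
  have AT q : q \in A.
    by have [a [b [aA /B0 -> ->]]] := AB1 q; rewrite addr0.
  have [||N Nmax] := @exists_maximal_submodule K (submod A)
      (sub_preim (sub_val A) L') (Sub (i oneT) (AT _)).
  + move=> x; have [a [l [lL xE]]] := iL (val x).
    exists a, (Sub l (AT l)); split; first by apply/submod_ofP.
    by apply: val_inj.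
  + by apply/negP => /submod_ofP /=; apply/negP.
  + by move/negP; apply; have : Rad (submod A) (Sub (i oneT) (AT _)); [rewrite RadA|apply].
Qed.

Lemma ring_decomposition : hereditary K -> noetherian K -> radical_decomposition ->
  exists (S T : pzRingType) (f : {rmorphism R -> (S * T)%type}),
    [/\ bijective f, semisimple_artinian S & right_small T].
Proof.
move=> hered noeth decomp; have [e [eP eB]] := ips_trace_central noeth.
have eP' : central_idempotent (1 - e).
  split=> [|x]; last by rewrite mulrBr mulrBl mulr1 mul1r (central_comm eP).
  by rewrite mulrBr mulr1 mulrBl mul1r (idempotent_mul eP) subrr subr0.
pose f x := (to_corner eP x, to_corner eP' x).
have fB : zmod_morphism f by move=> x y; rewrite /f !raddfB.
have fM : monoid_morphism f by split=> [|x y]; rewrite /f ?rmorph1 ?rmorphM.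
pose f' := HB.pack_for {rmorphism R -> (corner eP * corner eP')%type} f
  (GRing.isZmodMorphism.Build _ _ f fB) (GRing.isMonoidMorphism.Build _ _ f fM).
exists (corner eP), (corner eP'), f'; split.
- exists (fun st => val st.1 + val st.2) => [x|[s t]] /=.
    by rewrite -mulrDr addrC subrK mulr1.
  have se := corner_val s; have te := corner_val t.
  congr (_, _); apply: val_inj; rewrite /= mulrDl.
    by rewrite se -te -mulrA mulrBl mul1r (idempotent_mul eP) subrr mulr0 addr0.
  by rewrite te -se -mulrA mulrBr mulr1 (idempotent_mul eP) subrr mulr0 add0r.
- by apply: ips_corner_semisimple => // x /eB.
- apply: corner_small => // t te /eB et.
  by rewrite -te mulrBr mulr1 (central_comm eP) et subrr.
Qed.

End RingDecomposition.

(** * Products of a semisimple ring and a small ring *)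

Section ProductAlmostQF.
Variables (R S T : pzRingType) (f : {rmorphism R -> (S * T)%type}).
Variables (g : S * T -> R) (fK : cancel f g) (gK : cancel g f).
Local Notation K := (R^c).

Lemma inv_add u v : g (u + v) = g u + g v.
Proof. by apply: (can_inj fK); rewrite raddfD /= !gK. Qed.

Lemma inv_zero : g (0, 0) = 0.
Proof. by have := fK 0; rewrite raddf0. Qed.

Lemma inv_mul u v : g (u * v) = g u * g v.
Proof. by apply: (can_inj fK); rewrite rmorphM !gK. Qed.

(** In the converse ring the factors of a product are exchanged. *)
Lemma inv_mul_converse (u : S * T) (a : K) : g (u * f a) = a * (g u : K).
Proof. by rewrite inv_mul fK. Qed.

(** The map t |-> x t from T to Q extends to a map h on the hull E of T.  The
    values of h on E are T-components of elements of Q = xR, so they are already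
    values on T, and E is the sum of T and the kernel of h.  As T is superfluous,
    h = 0. *)
Lemma right_small_kills_cyclic (Q : lmodType K) (x : Q) :
  right_small T -> injective_module Q -> (forall q : Q, exists r : K, q = r *: x) ->
  (g (0, 1) : K) *: x = 0.
Proof.
move=> [E [i [[_ iinj _] small]]] Qinj gen.
pose p : {rmorphism K -> T^c} := converse_rmorphism (snd \o f).
have pE (r : K) : p r = (f r).2 by [].
have [i' i'E] := restr_linear p i.
have [|w wE] := @linear_exists K (restr p T^c^o) Q (fun t => (g (0, t) : K) *: x).
  move=> a s t; rewrite scalerA -scalerDl; congr (_ *: x).
  rewrite -inv_mul_converse -inv_add; congr g; congr (_, _).
  by rewrite /= mul0r addr0.
have [|h hE] := Qinj _ _ i' w; first by move=> s t; rewrite !i'E => /iinj.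
have {}hE t : h (i t) = (g (0, t) : K) *: x by rewrite -wE hE /= i'E.
have hZ (a : K) (y : E) : h (p a *: y) = a *: h y by rewrite -linearZ.
have hL : is_submod [set y : E | h y = 0].
  split=> [|y z /= hy hz|t y /= hy]; first exact: raddf0.
    by rewrite [LHS]raddfD /= hy hz addr0.
  have -> : t = p (g (0, t)) by rewrite pE gK.
  by rewrite hZ hy scaler0.
have sumL (y : E) : exists t, h (y - i t) = 0.
  have [r hr] := gen (h y).
  exists (f r).2; rewrite [LHS]raddfB /= hE.
  have -> : y = p (g (0, 1)) *: y by rewrite pE gK scale1r.
  rewrite hZ hr scalerA; apply/eqP; rewrite subr_eq0; apply/eqP; congr (_ *: x).
  rewrite -[r in LHS]fK -[LHS]inv_mul; congr g; congr (_, _).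
    exact: mulr0.
  exact: mulr1.
have : h (i 1) = 0.
  apply: contrapT => h1; apply: (small (submod_of hL)).
    by apply/proper_submoduleP; exists (i 1); apply/negP => /submod_ofP.
  apply/seteqP; split=> // y _; have [t ht] := sumL y.
  by exists (i t); [exists t|exists (y - i t); [exact/submod_ofP|rewrite addrC subrK]].
by rewrite hE.
Qed.

(** The unit of T annihilates x, by [right_small_kills_cyclic].  If b is the component of 1 in a complement B
    of the annihilator of x in S, then x b = x, and x r |-> b r is well defined,
    because b r is in B and is annihilated by x as soon as x r = 0.  This is a
    section of r |-> x r. *)
Lemma cyclic_injective_projective (Q : lmodType K) (x : Q) :
  semisimple_module S^c^o -> right_small T -> injective_module Q ->
  (forall q : Q, exists r : K, q = r *: x) -> projective_module Q.
Proof.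
move=> Sss Tsmall Qinj gen.
have e2x := right_small_kills_cyclic Tsmall Qinj gen.
have hA : is_submod [set s : S^c^o | (g (s, 0) : K) *: x = 0].
  split=> [|s t /= sx tx|a s /= sx].
  - by rewrite /= inv_zero scale0r.
  - have -> : g (s + t, 0) = (g (s, 0) : K) + g (t, 0).
      by rewrite -inv_add; congr g; congr (_, _); rewrite /= addr0.
    by rewrite scalerDl sx tx addr0.
  - have -> : g (a *: s, 0) = (g (a, 0) : K) * g (s, 0).
      by rewrite -inv_mul_converse gK; congr g; congr (_, _); rewrite /= mul0r.
    by rewrite -scalerA sx scaler0.
have [B /internal_direct_sumP[AB cap]] := Sss (submod_of hA).
have [a [b [/submod_ofP /= ax bB one]]] := AB 1.
pose b' : K := g (b, 0).
have bx : b' *: x = x.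
  have E : (1 : K) = (g (a, 0) : K) + b' + g (0, 1).
    rewrite -!inv_add -[LHS](fK 1) rmorph1; congr g; congr (_, _) => /=.
      by rewrite addr0.
    by rewrite !add0r.
  by rewrite -[RHS]scale1r E !scalerDl ax e2x add0r addr0.
have bM (r : K) : r * b' = g (((f r).1 : S^c) *: (b : S^c^o), 0).
  by rewrite -inv_mul_converse; congr g; congr (_, _); rewrite /= mul0r.
have b0 (r : K) : r *: x = 0 -> r * b' = 0.
  move=> rx; have c0 : ((f r).1 : S^c) *: (b : S^c^o) = 0.
    apply: cap; last exact: (@submodZ _ S^c^o).
    by apply/submod_ofP; rewrite /= -bM -scalerA bx.
  by rewrite bM c0 inv_zero.
have hG : is_submod [set z : (Q * K^o)%type | exists r : K, z = (r *: x, r * b')].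
  split=> [|_ _ [r ->] [s ->]|c _ [r ->]].
  - by exists 0; rewrite scale0r mul0r.
  - by exists (r + s); rewrite scalerDl mulrDl.
  - by exists (c * r); rewrite -scalerA -mulrA.
have [||s sG] := @linear_of_rel K Q K^o (submod_of hG).
- by move=> y /submod_ofP[r [/esym/b0 r0 ->]].
- by move=> q; have [r ->] := gen q; exists (r * b'); apply/submod_ofP; exists r.
have [|u uE] := @linear_exists K K^o Q (fun r => (r : K) *: x).
  by move=> c r t; rewrite scalerDl scalerA.
apply: (projective_retract (s := s) (p := u)); last exact: free_projective.
move=> q; have /submod_ofP[r [-> ->]] := sG q.
by rewrite uE -scalerA bx.
Qed.

(** The image of h is injective since R is hereditary, and cyclic since it is
    then a direct summand of R/I. *)
Lemma product_almost_QF : hereditary K ->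
  semisimple_module S^c^o -> right_small T -> right_almost_QF R.
Proof.
move=> hered Sss Tsmall E Einj I h.
pose Q := submod (sub_range h).
have [|h' h'E] := @lift_sub _ _ _ (sub_range h) h.
  by move=> y; apply/submod_ofP; exists y.
have Qinj : injective_module Q.
  apply: (hereditary_quotient (u := h') hered Einj) => -[q qh].
  by have /submod_ofP[y _ yq] := qh; exists y; apply: val_inj; rewrite h'E.
have [p pK] := injective_retraction (s := sub_val (sub_range h)) Qinj val_inj.
have gen (q : Q) : exists r : K, q = r *: p (quot_proj I 1).
  have [r rE] := quot_proj_surj (val q); exists (r : K).
  rewrite -!linearZ -[LHS]pK; congr (p _); rewrite /= -rE; congr (quot_proj I _).
  exact: (esym (mulr1 (r : K))).
have Qproj := cyclic_injective_projective Sss Tsmall Qinj gen.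
have [k kE] := projective_lift (f := quot_proj I) (g := sub_val (sub_range h)) Qproj
  (fun q => quot_proj_surj _).
by exists (k \o h') => y /=; rewrite kE /= h'E.
Qed.

End ProductAlmostQF.

Theorem theorem1 (R : pzRingType)
    (hered : right_hereditary R) (noeth : right_noetherian R) :
  [<-> right_almost_QF R;
       right_max_QF R;
       (forall E : lmodType R^c, injective_module E ->
          exists A B : submodClosed E,
            [/\ internal_direct_sum A B,
                Rad (submod A) = setT,
                projective_module (submod B) &
                semisimple_module (submod B)]);
       (exists (S T : pzRingType) (f : {rmorphism R -> (S * T)%type}),
          [/\ bijective f, semisimple_artinian S & right_small T])].
Proof.
tfae.
- by move=> aQF E Einj I _ f; apply: aQF.
- by move=> mQF E; apply: max_QF_decomposition.
- exact: ring_decomposition.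
- move=> [S [T [f [[g fK gK] [Sss _] Tsmall]]]].
  exact: product_almost_QF fK gK hered Sss Tsmall.
Qed.
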